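(* Let $K\subset\mathbb{R}^2$ be a parallelogram that is neither a rectangle nor a rhombus, with side length ratio $r>1$ and larger interior angle $\theta\in(\frac{\pi}{2},\pi)$. Define $\Psi_1,\Psi_2:(1,\infty)\to(\frac{\pi}{2},\pi)$ by $$\Psi_1(r)=\begin{cases}\arccos\left(-\frac12\left(r-\frac1r\right)\right)&\text{if } r\in(1,\sqrt2),\\ \arccos\left(-\frac12\cdot\frac{-r^2+\sqrt{r^4+6r^2-7}+1}{2r}\right)&\text{if } r\ge\sqrt2,\end{cases}$$ $$\Psi_2(r)=\begin{cases}\arccos\left(-\frac12\left(\frac1r+\sqrt{2-r^2}\right)\right)&\text{if } r\in(1,\sqrt2),\\ \arccos\left(-\frac12\cdot\frac{-r^2+\sqrt{r^4+6r^2-7}+1}{2r}\right)&\text{if } r\ge\sqrt2.\end{cases}$$ Let $$\mathcal{D}=\left\{(r,\theta) : 1<r,\ \tfrac{\pi}{2}<\theta\le\Psi_1(r)\right\},\qquad \mathcal{J}=\left\{(r,\theta) : 1<r,\ \pi>\theta\ge\Psi_2(r)\right\},$$ $$\mathcal{B}=\left((1,\infty)\times\left(\tfrac{\pi}{2},\pi\right)\right)\setminus(\mathcal{J}\cup\mathcal{D}).$$ Then $\alpha_1(K)=R(K,\Phi_U(K))$, where (i) $U$ is the angle bisector of two consecutive edges of $K$ whenever $(r,\theta)\in\mathcal{B}$, (ii) $U$ is an angle bisector of the diagonals of $K$ whenever $(r,\theta)\in\mathcal{D}$, and (iii) $U$ is a principal axis of the John ellipse of $K$ whenever $(r,\thet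a)\in\mathcal{J}$.
   Context: Parallelograms are non-degenerate. The side length ratio of a parallelogram is the length of a longer edge divided by the length of a shorter edge. The John ellipse of $K$ is the unique ellipse of maximal area contained in $K$. For an affine subspace $U\subset\mathbb{R}^2$, $P_U$ is the orthogonal projection onto $U$ and $\Phi_U(x)=2P_U(x)-x$ is the reflection across $U$. For convex bodies (compact convex sets with nonempty interior) $K,C\subset\mathbb{R}^2$, $R(K,C)=\inf\{\lambda>0 : K\subset z+\lambda C\text{ for some }z\in\mathbb{R}^2\}$. The first Minkowski chirality is $\alpha_1(K)=\inf\{R(K,\Phi_U(K)) : U\subset\mathbb{R}^2\text{ affine subspace},\ \dim U=1\}$. *)

(* Defs.v *)
From HB Require Import structures.
From mathcomp Require Import all_boot all_order all_algebra.
From mathcomp Require Import all_classical all_reals all_analysis.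

Set Implicit Arguments.
Unset Strict Implicit.
Unset Printing Implicit Defensive.

Import Order.TTheory GRing.Theory Num.Theory.
Import numFieldNormedType.Exports.

Local Open Scope classical_set_scope.
Local Open Scope ring_scope.

(** The Euclidean plane is [R * R].  The library norm on a product is the sup
    norm, so lengths and angles are defined from the dot product below. *)

Definition dot (R : realType) (x y : R * R) : R := x.1 * y.1 + x.2 * y.2.

Definition len (R : realType) (x : R * R) : R := Num.sqrt (dot x x).

Definition det2 (R : realType) (x y : R * R) : R := x.1 * y.2 - x.2 * y.1.

(** Unoriented angle between two nonzero vectors, in [[0, pi]]. *)
Definition angle (R : realType) (x y : R * R) : R :=
  acos (dot x y / (len x * len y)).

Definition line (R : realType) (o w : R * R) : set (R * R) :=
  [set o + t *: w | t in [set: R]].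

Definition is_line (R : realType) (U : set (R * R)) : Prop :=
  exists o w : R * R, w != 0 /\ U = line o w.

(** The point [y] of [U] such that [x - y] is orthogonal to all directions of
    [U]; it exists and is unique when [U] is an affine subspace. *)
Definition proj (R : realType) (U : set (R * R)) (x : R * R) : R * R :=
  get [set y : R * R | U y /\ forall z, U z -> dot (x - y) (z - y) = 0].

Definition reflection (R : realType) (U : set (R * R)) (x : R * R) : R * R :=
  2 *: proj U x - x.

Definition circumradius (R : realType) (K C : set (R * R)) : R :=
  inf [set lambda : R | 0 < lambda /\
    exists z : R * R, K `<=` [set z + lambda *: c | c in C]].

Definition minkowski_chirality1 (R : realType) (K : set (R * R)) : R :=
  inf [set circumradius K (reflection U @` K) | U in @is_line R].

(** The parallelogram with consecutive vertices [corner], [corner + side1],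
    [corner + side1 + side2], [corner + side2]. *)
Record parallelogram (R : realType) := Parallelogram {
  corner : R * R;
  side1 : R * R;
  side2 : R * R;
  nondegenerate : det2 side1 side2 != 0
}.

Definition body (R : realType) (P : parallelogram R) : set (R * R) :=
  [set x | exists s t : R, [/\ 0 <= s <= 1, 0 <= t <= 1 &
    x = corner P + s *: side1 P + t *: side2 P]].

Definition is_rectangle (R : realType) (P : parallelogram R) : Prop :=
  angle (side1 P) (side2 P) = pi / 2.

Definition is_rhombus (R : realType) (P : parallelogram R) : Prop :=
  len (side1 P) = len (side2 P).

Definition side_ratio (R : realType) (P : parallelogram R) : R :=
  Num.max (len (side1 P)) (len (side2 P)) /
  Num.min (len (side1 P)) (len (side2 P)).

(** The interior angles at [corner] and at the adjacent vertex
    [corner + side1]; opposite vertices have equal angles. *)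
Definition larger_angle (R : realType) (P : parallelogram R) : R :=
  Num.max (angle (side1 P) (side2 P)) (angle (- side1 P) (side2 P)).

(** [U] bisects the angle with apex [o] and rays directed by [a] and [b]. *)
Definition bisects (R : realType) (U : set (R * R)) (o a b : R * R) : Prop :=
  exists w : R * R, [/\ w != 0, U = line o w,
    angle a w = angle a b / 2 & angle w b = angle a b / 2].

(** One case for each vertex; the rays are the two edges leaving it. *)
Definition bisects_consecutive_edges (R : realType) (P : parallelogram R)
    (U : set (R * R)) : Prop :=
  let p := corner P in let u := side1 P in let v := side2 P in
  [\/ bisects U p u v, bisects U (p + u) (- u) v,
      bisects U (p + u + v) (- u) (- v) | bisects U (p + v) u (- v)].

(** The diagonals are crossing lines, hence have two bisectors, one for each
    pair of vertical angles. *)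
Definition bisects_diagonals (R : realType) (P : parallelogram R)
    (U : set (R * R)) : Prop :=
  let m := corner P + 2^-1 *: (side1 P + side2 P) in
  let d1 := side1 P + side2 P in let d2 := side2 P - side1 P in
  bisects U m d1 d2 \/ bisects U m d1 (- d2).

(** The ellipse with centre [c], orthonormal axis directions [e1], [e2] and
    semi-axes [a], [b]. *)
Definition ellipse (R : realType) (c e1 e2 : R * R) (a b : R) : set (R * R) :=
  [set p | exists x y : R, (x / a) ^+ 2 + (y / b) ^+ 2 <= 1 /\
    p = c + x *: e1 + y *: e2].

Definition ellipse_axes (R : realType) (E : set (R * R)) (c e1 e2 : R * R)
    (a b : R) : Prop :=
  [/\ dot e1 e1 = 1, dot e2 e2 = 1, dot e1 e2 = 0, 0 < a /\ 0 < b &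
      E = ellipse c e1 e2 a b].

Definition is_ellipse (R : realType) (E : set (R * R)) : Prop :=
  exists (c e1 e2 : R * R) (a b : R), ellipse_axes E c e1 e2 a b.

(** Exchanging the roles of [e1] and [e2] gives the other axis. *)
Definition principal_axis (R : realType) (E U : set (R * R)) : Prop :=
  exists (c e1 e2 : R * R) (a b : R),
    ellipse_axes E c e1 e2 a b /\ U = line c e1.

Definition area (R : realType) (A : set (R * R)) : \bar R :=
  (@lebesgue_measure R \x @lebesgue_measure R)%E A.

Definition john_ellipse (R : realType) (K : set (R * R)) : set (R * R) :=
  get [set E : set (R * R) | [/\ is_ellipse E, E `<=` K &
    forall E', is_ellipse E' -> E' `<=` K -> E' <> E -> (area E' < area E)%E]].

(** The common expression of [Psi1] and [Psi2] for [r >= sqrt 2]. *)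
Definition Psi_tail (R : realType) (r : R) : R :=
  acos (- (2^-1 * ((- r ^+ 2 + Num.sqrt (r ^+ 4 + 6 * r ^+ 2 - 7) + 1)
                   / (2 * r)))).

Definition Psi1 (R : realType) (r : R) : R :=
  if r < Num.sqrt 2 then acos (- (2^-1 * (r - r^-1))) else Psi_tail r.

Definition Psi2 (R : realType) (r : R) : R :=
  if r < Num.sqrt 2 then acos (- (2^-1 * (r^-1 + Num.sqrt (2 - r ^+ 2))))
  else Psi_tail r.

Definition regionD (R : realType) : set (R * R) :=
  [set q | 1 < q.1 /\ pi / 2 < q.2 <= Psi1 q.1].

Definition regionJ (R : realType) : set (R * R) :=
  [set q | 1 < q.1 /\ Psi2 q.1 <= q.2 < pi].

Definition regionB (R : realType) : set (R * R) :=
  ([set r | 1 < r] `*` [set theta | pi / 2 < theta < pi])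
  `\` (@regionJ R `|` @regionD R).

(* Main.v *)
Require Import Defs.
From HB Require Import structures.
From mathcomp Require Import all_boot all_order all_algebra.
From mathcomp Require Import all_classical all_reals all_analysis.
From mathcomp Require Import measurable_realfun ring lra.

(* In the basis formed by the two sides of the parallelogram, the linear part of
   the reflection across a line has a matrix [[a, b], [c, -a]] of determinant
   -1, and the circumradius of K with respect to its mirror image is the norm
   |a| + max(|b|, |c|) of this matrix.  As the line turns, (a, b, c) runs over
   an ellipse, on the arcs of which this norm is concave, so it is minimal at
   a = 0 (bisectors of edges), b = -c (bisectors of the diagonals) or b = c
   (axes of the John ellipse, since the reflection then preserves the affine
   image of the inscribed disc).  The three values are r,
   sqrt ((r^2 + 1 + m) / (r^2 + 1 - m)) and sqrt (1 + 2 n m / (n^2 + m^2)),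
   where n = r^2 - 1 and m = - 2 r cos theta; comparing them yields the curves
   Psi1 and Psi2. *)

Set Implicit Arguments.
Unset Strict Implicit.
Unset Printing Implicit Defensive.

Import Order.TTheory GRing.Theory Num.Theory.
Import numFieldNormedType.Exports.

Local Open Scope classical_set_scope.
Local Open Scope ring_scope.

(** * Minimizing the norm of a reflection matrix *)

(** In side coordinates centred at its midpoint, [K] is a square, hence a ball of the sup norm, and
    the reflection matrix is its own inverse. So [K] fits into a translate of [lambda] times its
    mirror image exactly when the matrix maps the square into [lambda] times itself, and the least
    such [lambda] is the maximal row sum. Only the direction of the line matters. In [n] and [m] the
    comparisons are polynomial: diagonals against edges is decided by the line [m = n], John axes
    against edges by the circle [n^2 + m^2 = 2 m], and diagonals against John axes by
    [m^2 + n m = 2 n]. For positive [n], [m] these curves meet only at [n = m = 1], that is at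
    [r = sqrt 2], where [Psi1] and [Psi2] change branch. The John ellipse is defined by its area, so
    it has to be identified first. This is the equality case of Hadamard's inequality for the matrix
    of the semi-axes in side coordinates; of the area one needs only that it is a positive multiple
    of the product of the semi-axes. *)

Lemma chord_bound (F : realFieldType) (x y p q V B : F) :
  0 <= x -> 0 <= y -> 0 <= V -> V <= p -> V <= q -> B <= 2 ->
  x ^+ 2 + y ^+ 2 + x * y * B = 1 -> V <= x * p + y * q.
Proof.
move=> x0 y0 V0 Vp Vq B2 E.
have xy0 : 0 <= x * y by rewrite mulr_ge0.
have xyB : x * y * B <= x * y * 2 by rewrite ler_wpM2l.
(* [B <= 2] says that the arc bulges beyond its chord: the point with coefficients [x], [y] in the
   two end points has [x + y >= 1]. *)
have h : 1 <= (x + y) ^+ 2 by nra.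
have h1 : 1 <= x + y.
  by rewrite -(@ler_pXn2r _ 2) ?nnegrE ?addr_ge0// expr1n.
have : x * V + y * V <= x * p + y * q by rewrite lerD// ler_wpM2l.
by apply: le_trans; rewrite -mulrDl ler_peMl.
Qed.

(* The triples [(a, b, c)] form an ellipse in a plane.  The corners of
   [|a| + max |b| |c|] on it are [(0, 1 / r, r)], [aJ (1, t, t)] and
   [aD (1, w, - w)]; on the sector between two consecutive corners the function
   is linear, hence on the arc it is at least the smaller of the two end
   values. *)
Lemma reflection_radius_ge (F : realFieldType) (r k a b c t w aJ aD V : F) :
  1 < r -> 0 < k < 1 -> a ^+ 2 + b * c = 1 -> r * b - c / r = 2 * k * a ->
  t = 2 * r * k / (r ^+ 2 - 1) -> w = 2 * r * k / (r ^+ 2 + 1) ->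
  0 < aJ -> aJ ^+ 2 * (1 + t ^+ 2) = 1 ->
  0 < aD -> aD ^+ 2 * (1 - w ^+ 2) = 1 ->
  V <= r -> V <= aJ * (1 + t) -> V <= aD * (1 + w) ->
  V <= `|a| + Num.max `|b| `|c|.
Proof.
move=> r1 /andP[k0 k1] Q L tE wE aJ0 aJE aD0 aDE Vr VJ VD.
have [V0|V0] := ltP V 0.
  by apply: ltW; apply: lt_le_trans V0 _; rewrite addr_ge0// le_max normr_ge0.
have r0 : 0 < r by apply: lt_trans r1.
have r21 : 0 < r ^+ 2 - 1 by nra.
have r22 : 0 < r ^+ 2 + 1 by nra.
have t0 : 0 < t by rewrite tE divr_gt0 // !mulr_gt0.
have w0 : 0 < w by rewrite wE divr_gt0 // !mulr_gt0.
(* Negating the triple amounts to passing to the orthogonal line. *)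
wlog a0 : a b c Q L / 0 <= a.
  move=> H; have [a0|/ltW a0] := leP 0 a; first exact: H.
  rewrite -(normrN a) -(normrN b) -(normrN c).
  apply: H; last by rewrite oppr_ge0.
  - by rewrite -Q; ring.
  - have -> : 2 * k * - a = - (2 * k * a) by ring.
    by rewrite -L; ring.
have Lc : c = r * (r * b - 2 * k * a).
  by rewrite -L; field; rewrite gt_eqF.
(* The other symmetry of the ellipse fixes [a] and exchanges [r b] with [- c / r]. It need not
   preserve the norm, but it does not increase it on the half to be discarded: there
   [c <= r^2 b <= - c], so [|c|] dominates both new entries. *)
wlog s0 : b c Q L Lc / 0 <= r ^+ 2 * b + c.
  move=> H; have [s0|/ltW s0] := leP 0 (r ^+ 2 * b + c); first exact: (H b c).
  have b'E : - c / r ^+ 2 = (2 * k * a - r * b) / r.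
    by rewrite Lc; field; rewrite gt_eqF.
  have h : V <= `|a| + Num.max `|- c / r ^+ 2| `|- b * r ^+ 2|.
    apply: H.
    - by rewrite -Q; field; rewrite gt_eqF.
    - by rewrite -L; field; rewrite gt_eqF.
    - by rewrite Lc; field; rewrite gt_eqF.
    - have -> : r ^+ 2 * (- c / r ^+ 2) + - b * r ^+ 2 = - (r ^+ 2 * b + c).
        by field; rewrite gt_eqF.
      by rewrite oppr_ge0.
  apply: (le_trans h); rewrite lerD2l ge_max; apply/andP; split.
    rewrite le_max; apply/orP; right.
    rewrite normrM normrN normfV (ger0_norm (sqr_ge0 _)).
    rewrite ler_pdivrMr ?exprn_gt0//.
    by rewrite ler_peMr//; nra.
  rewrite le_max; apply/orP; right.
  have ka : 0 <= r * (k * a) by rewrite !mulr_ge0// ltW.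
  have c0 : c <= 0 by rewrite Lc in s0 *; nra.
  rewrite (ler0_norm c0) normrM normrN (ger0_norm (sqr_ge0 _)).
  rewrite -[_ ^+ 2]ger0_norm ?sqr_ge0// -normrM ler_norml.
  by apply/andP; split; rewrite Lc in s0 *; nra.
have ra0 : 0 <= r * (k * a) by rewrite !mulr_ge0// ltW.
have b0 : 0 <= b.
  have : 0 <= r ^+ 2 * b by rewrite Lc in s0; nra.
  by rewrite pmulr_rge0 ?exprn_gt0.
have tK : t * (r ^+ 2 - 1) = 2 * r * k by rewrite tE divfK// gt_eqF.
have wK : w * (r ^+ 2 + 1) = 2 * r * k by rewrite wE divfK// gt_eqF.
rewrite (ger0_norm a0) (ger0_norm b0).
(* Sector from [(0, 1 / r, r)] to [aJ (1, t, t)]: the coefficients in these corners are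
   [(c - t a) / r] and [a / aJ]. The mixed term is at most 2 because [t (r^2 - 1) / r = 2 k] and
   [k < 1]. *)
have [bc|cb] := leP b c.
  have c0 := le_trans b0 bc.
  rewrite (ger0_norm c0) (max_idPr bc).
  have cta : 0 <= c - t * a.
    have : 0 <= (c - t * a) * (r ^+ 2 - 1).
      rewrite mulrBl -mulrA (mulrC a) mulrA tK.
      have : 0 <= (c - b) * r ^+ 2 by rewrite mulr_ge0 ?sqr_ge0// subr_ge0.
      by rewrite Lc; nra.
    by rewrite pmulr_lge0.
  have x0 : 0 <= (c - t * a) / r by rewrite divr_ge0// ltW.
  have y0 : 0 <= a / aJ by rewrite divr_ge0// ltW.
  have -> : a + c = (c - t * a) / r * r + a / aJ * (aJ * (1 + t)).
    by field; rewrite !gt_eqF.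
  apply: (@chord_bound _ _ _ _ _ _ (aJ * t * (r + r^-1))) => //.
    have rV0 : 0 < r + r^-1 by rewrite addr_gt0// invr_gt0.
    rewrite -(@ler_pXn2r _ 2) ?nnegrE//; last by rewrite ltW// !mulr_gt0.
    have -> : (aJ * t * (r + r^-1)) ^+ 2 =
        aJ ^+ 2 * ((t * (r ^+ 2 - 1) / r) ^+ 2 + 4 * t ^+ 2).
      by field; rewrite gt_eqF.
    rewrite tK (_ : 2 * r * k / r = 2 * k); last by field; rewrite gt_eqF.
    have -> : 2 ^+ 2 = aJ ^+ 2 * (4 + 4 * t ^+ 2) 
      by rewrite -[LHS]mulr1 -[X in _ * X]aJE; ring.
    by rewrite ler_wpM2l ?sqr_ge0//; nra.
  have aJV : aJ ^- 2 = 1 + t ^+ 2.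
    exact: mulr1_eq.
  rewrite -Q.
  have bE : b = 2 * k * a / r + c / r ^+ 2 by rewrite Lc; field; rewrite gt_eqF.
  have kE : 2 * k = t * (r ^+ 2 - 1) / r by rewrite tK; field; rewrite gt_eqF.
  have -> : (a / aJ) ^+ 2 = a ^+ 2 * (1 + t ^+ 2) by rewrite exprMn exprVn aJV.
  rewrite bE kE; field; by rewrite !gt_eqF.
have [cNb|Nbc] := leP c (- b).
  have c0 : c <= 0 by rewrite (le_trans cNb)// oppr_le0.
  rewrite (ler0_norm c0) (_ : Num.max b (- c) = - c); last first.
    by apply/max_idPr; rewrite lerNr.
  have wa : w * a <= - c.
    have : 0 <= (- c - w * a) * (r ^+ 2 + 1).
      rewrite mulrBl -mulrA (mulrC a) mulrA wK.
      have : 0 <= (- b - c) * r ^+ 2 by rewrite mulr_ge0 ?sqr_ge0// subr_ge0.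
      by rewrite Lc; nra.
    by rewrite pmulr_lge0// subr_ge0.
  have h1 : 0 <= w * a - b.
    have : 0 <= (w * a - b) * (r ^+ 2 + 1).
      rewrite mulrBl -mulrA (mulrC a) mulrA wK.
      by rewrite Lc in cNb; nra.
    by rewrite pmulr_lge0.
  have h2 : 0 <= r ^+ 2 * b - w * a.
    have : 0 <= (r ^+ 2 * b - w * a) * (r ^+ 2 + 1).
      rewrite mulrBl -mulrA -(mulrA w) (mulrC a) (mulrA w) wK.
      have h : 0 <= r ^+ 2 * b - r * (k * a) by rewrite Lc in s0; nra.
      have h' : 0 <= (r ^+ 2 * b - r * (k * a)) * (r ^+ 2 + 1).
        by rewrite mulr_ge0// ltW.
      have h'' : 0 <= r * (k * a) * (r ^+ 2 - 1) by rewrite mulr_ge0// ltW.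
      by nra.
    by rewrite pmulr_lge0.
  have h3 : 0 <= - c * b - w ^+ 2 * a ^+ 2.
    have := mulr_ge0 h1 h2; congr (0 <= _).
    have -> : (w * a - b) * (r ^+ 2 * b - w * a) =
        w * (r ^+ 2 + 1) * (a * b) - r ^+ 2 * b ^+ 2 - w ^+ 2 * a ^+ 2 by ring.
    by rewrite wK Lc; ring.
  have h4 : aD <= a.
    rewrite -(@ler_pXn2r _ 2) ?nnegrE ?(ltW aD0)//.
    have e : 0 < 1 - w ^+ 2.
      by rewrite -(@pmulr_rgt0 _ (aD ^+ 2)) ?exprn_gt0// aDE.
    by rewrite -(ler_pM2r e) aDE -[leLHS]Q; lra.
  apply: (le_trans VD); rewrite mulrDr mulr1 lerD//.
  by apply: le_trans wa; rewrite mulrC ler_pM2l.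
rewrite (_ : Num.max b `|c| = b); last first.
  by apply/max_idPl; rewrite ler_norml (ltW Nbc) (ltW cb).
have LL : r ^+ 2 * b - c = 2 * r * k * a by rewrite Lc; ring.
(* Sector between the two remaining corners: [X] and [Y] are the coordinates in the directions
   [(1, t, t)] and [(1, w, - w)]. *)
pose X := (b + c) / (2 * t); pose Y := (b - c) / (2 * w).
have X0 : 0 <= X by rewrite /X divr_ge0 ?mulr_ge0 ?(ltW t0)//; lra.
have Y0 : 0 <= Y by rewrite /Y divr_ge0 ?mulr_ge0 ?(ltW w0)//; lra.
have bE : b = t * X + w * Y by rewrite /X /Y; field; rewrite !gt_eqF.
have cE : c = t * X - w * Y by rewrite /X /Y; field; rewrite !gt_eqF.
have aE : a = X + Y.
  have h : (2 * r * k) != 0 by rewrite gt_eqF// !mulr_gt0.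
  apply: (mulfI h); rewrite -LL bE cE.
  transitivity (t * (r ^+ 2 - 1) * X + w * (r ^+ 2 + 1) * Y); first by ring.
  by rewrite tK wK; ring.
have aJV : aJ ^- 2 = 1 + t ^+ 2.
  exact: mulr1_eq.
have aDV : aD ^- 2 = 1 - w ^+ 2.
  exact: mulr1_eq.
have -> : a + b = X / aJ * (aJ * (1 + t)) + Y / aD * (aD * (1 + w)).
  by rewrite aE bE; field; rewrite !gt_eqF.
apply: (@chord_bound _ _ _ _ _ _ (2 * (aJ * aD))) => //.
- by rewrite divr_ge0// ltW.
- by rewrite divr_ge0// ltW.
- rewrite ler_piMr//.
  rewrite -(@ler_pXn2r _ 2) ?nnegrE ?mulr_ge0 ?(ltW aJ0) ?(ltW aD0)// expr1n.
  have e : 1 <= (1 + t ^+ 2) * (1 - w ^+ 2).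
    have h : (1 + t ^+ 2) * (1 - w ^+ 2) - 1 =
        (2 * t * w) ^+ 2 / (2 * r * k) ^+ 2 * r ^+ 2 * (1 - k ^+ 2).
      rewrite tE wE; field.
      by rewrite !gt_eqF.
    have k2 : 0 <= 1 - k ^+ 2 by rewrite subr_ge0 expr_le1// ltW.
    rewrite -subr_ge0 h; apply: mulr_ge0 => //; apply: mulr_ge0; last first.
      exact: sqr_ge0.
    by apply: divr_ge0; exact: sqr_ge0.
  have e' : 0 < aJ ^+ 2 * aD ^+ 2 by rewrite mulr_gt0// exprn_gt0.
  rewrite exprMn -[leLHS]mulr1; apply: (le_trans (ler_wpM2l (ltW e') e)).
  by rewrite mulrACA aJE aDE mulr1.
- rewrite !exprMn !exprVn aJV aDV -[RHS]Q bE cE aE.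
  by field; rewrite !gt_eqF.
Qed.

(* In the basis formed by the sides, of lengths [l1], [l2] and angle
   [acos kappa], a linear reflection has a matrix [[a, b], [c, -a]] satisfying
   these two equations. *)
Definition reflection_triple (F : realFieldType) (l1 l2 kappa a b c : F) :=
  a ^+ 2 + b * c = 1 /\ l1 ^+ 2 * b - l2 ^+ 2 * c = 2 * l1 * l2 * kappa * a.

(** Negated cosines of the threshold angles: since [acos] decreases, comparing the larger angle with
    a threshold becomes comparing [k], the negated cosine of that angle, with these numbers in the
    same direction. *)
Definition neg_cos_Psi_tail (R : realType) (r : R) : R :=
  2^-1 * ((- r ^+ 2 + Num.sqrt (r ^+ 4 + 6 * r ^+ 2 - 7) + 1) / (2 * r)).

Definition neg_cos_Psi1 (R : realType) (r : R) : R :=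
  if r < Num.sqrt 2 then 2^-1 * (r - r^-1) else neg_cos_Psi_tail r.

Definition neg_cos_Psi2 (R : realType) (r : R) : R :=
  if r < Num.sqrt 2 then 2^-1 * (r^-1 + Num.sqrt (2 - r ^+ 2))
  else neg_cos_Psi_tail r.

Definition john_axis_sqr_radius (F : fieldType) (r k : F) : F :=
  1 + 2 * (r ^+ 2 - 1) * (2 * r * k) / ((r ^+ 2 - 1) ^+ 2 + (2 * r * k) ^+ 2).

Definition diagonal_bisector_sqr_radius (F : fieldType) (r k : F) : F :=
  1 + 2 * (2 * r * k) / (r ^+ 2 + 1 - 2 * r * k).

(** * Comparison of the three candidate values *)

Section Values.
Context {R : realType} {r k : R}.
Context (r1 : 1 < r) (k01 : 0 < k < 1).

Let r0 : 0 < r. Proof. exact: lt_trans r1. Qed.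
Let k0 : 0 < k. Proof. by case/andP: k01. Qed.
Let k1 : k < 1. Proof. by case/andP: k01. Qed.

Let n := r ^+ 2 - 1.
Let m := 2 * r * k.

Let n0 : 0 < n. Proof. by rewrite subr_gt0 exprn_egt1. Qed.
Let m0 : 0 < m. Proof. by rewrite /m !mulr_gt0. Qed.
Let mn2 : m < n + 2.
Proof.
have h : r * k < r by rewrite gtr_pMr.
have := sqr_ge0 (r - 1).
by rewrite /m /n -mulrA sqrrB; lra.
Qed.
Let nm0 : 0 < n ^+ 2 + m ^+ 2. Proof. by rewrite addr_gt0// exprn_gt0. Qed.
Let n2m0 : 0 < n + 2 - m. Proof. by rewrite subr_gt0. Qed.

Local Notation VJ := (john_axis_sqr_radius r k).
Local Notation VD := (diagonal_bisector_sqr_radius r k).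

Let VJE : VJ = 1 + 2 * n * m / (n ^+ 2 + m ^+ 2). Proof. by []. Qed.

Let VDE : VD = 1 + 2 * m / (n + 2 - m).
Proof.
have -> : n + 2 - m = r ^+ 2 + 1 - 2 * r * k by rewrite /n /m; ring.
by [].
Qed.

Lemma radius_edge_bisector (b c : R) :
  b * c = 1 -> r * b - c / r = 0 -> Num.max `|b| `|c| = r.
Proof.
move=> bc h.
have cE : c = r ^+ 2 * b.
  have /eqP := h; rewrite subr_eq0 => /eqP e.
  have -> : c = r * (c / r) by field; rewrite gt_eqF.
  by rewrite -e; ring.
have rb : r * `|b| = 1.
  apply/eqP; rewrite -(@pexpr_eq1 _ _ 2) ?mulr_ge0 ?(ltW r0)//.
  by rewrite exprMn real_normK ?num_real// -bc cE; apply/eqP; ring.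
have cr : `|c| = r.
  by rewrite cE normrM ger0_norm ?sqr_ge0// expr2 -mulrA rb mulr1.
rewrite cr; apply/max_idPr.
have : `|b| = r^-1.
  by apply: (mulfI (lt0r_neq0 r0)); rewrite rb divff// lt0r_neq0.
by move=> ->; rewrite (le_trans _ (ltW r1))// invf_le1// ltW.
Qed.

Lemma radius_john_axis (a b : R) :
  a ^+ 2 + b * b = 1 -> r * b - b / r = 2 * k * a -> (`|a| + `|b|) ^+ 2 = VJ.
Proof.
move=> Q L.
have nb : n * b = m * a.
  have -> : m * a = r * (2 * k * a) by rewrite /m; ring.
  by rewrite -L /n; field; rewrite gt_eqF.
have nbE : n * `|b| = m * `|a|.
  by rewrite -[n]gtr0_norm// -normrM nb normrM [`|m|]gtr0_norm.
have aE : `|a| ^+ 2 = n ^+ 2 / (n ^+ 2 + m ^+ 2).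
  rewrite real_normK ?num_real//; apply: (mulIf (lt0r_neq0 nm0)).
  rewrite divfK ?lt0r_neq0//.
  transitivity (n ^+ 2 * (a ^+ 2 + b * b)); last by rewrite Q mulr1.
  transitivity ((n * a) ^+ 2 + (m * a) ^+ 2); first by ring.
  by rewrite -nb; ring.
have bE : `|b| = m / n * `|a|.
  by apply: (mulfI (lt0r_neq0 n0)); rewrite nbE; field; rewrite gt_eqF.
rewrite bE; transitivity ((1 + m / n) ^+ 2 * `|a| ^+ 2); first by ring.
by rewrite aE VJE; field; rewrite !gt_eqF.
Qed.

Lemma radius_diagonal_bisector (a b : R) :
  a ^+ 2 - b * b = 1 -> r * b + b / r = 2 * k * a -> (`|a| + `|b|) ^+ 2 = VD.
Proof.
move=> Q L.
have nb : (n + 2) * b = m * a.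
  have -> : m * a = r * (2 * k * a) by rewrite /m; ring.
  by rewrite -L /n; field; rewrite gt_eqF.
have n20 : 0 < n + 2 by rewrite addr_gt0.
have nbE : (n + 2) * `|b| = m * `|a|.
  by rewrite -[n + 2]gtr0_norm// -normrM nb normrM [`|m|]gtr0_norm.
have nm : 0 < (n + 2) ^+ 2 - m ^+ 2 by rewrite subr_sqr mulr_gt0// addr_gt0.
have aE : `|a| ^+ 2 = (n + 2) ^+ 2 / ((n + 2) ^+ 2 - m ^+ 2).
  rewrite real_normK ?num_real//; apply: (mulIf (lt0r_neq0 nm)).
  rewrite divfK ?lt0r_neq0//.
  transitivity ((n + 2) ^+ 2 * (a ^+ 2 - b * b)); last by rewrite Q mulr1.
  transitivity (((n + 2) * a) ^+ 2 - (m * a) ^+ 2); first by ring.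
  by rewrite -nb; ring.
have bE : `|b| = m / (n + 2) * `|a|.
  by apply: (mulfI (lt0r_neq0 n20)); rewrite nbE; field; rewrite gt_eqF.
rewrite bE; transitivity ((1 + m / (n + 2)) ^+ 2 * `|a| ^+ 2); first by ring.
have nmp : 0 < n + 2 + m by rewrite addr_gt0.
rewrite aE subr_sqr VDE; field.
by rewrite (gt_eqF n20) (gt_eqF n2m0) (gt_eqF nmp).
Qed.

Lemma reflection_radius_sqr_ge (a b c V : R) :
  a ^+ 2 + b * c = 1 -> r * b - c / r = 2 * k * a -> 0 <= V ->
  V ^+ 2 <= r ^+ 2 -> V ^+ 2 <= VJ -> V ^+ 2 <= VD ->
  V <= `|a| + Num.max `|b| `|c|.
Proof.
move=> Q L V0 Vr VVJ VVD.
have nE : r ^+ 2 + 1 = n + 2 by rewrite /n; ring.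
have n20 : 0 < n + 2 by rewrite addr_gt0.
pose t := m / n; pose w := m / (n + 2).
have t0 : 0 < t by rewrite divr_gt0.
have w0 : 0 < w by rewrite divr_gt0.
have t2 : 0 < 1 + t ^+ 2 by rewrite addr_gt0// exprn_gt0.
have w1 : w < 1 by rewrite ltr_pdivrMr// mul1r.
have w2 : 0 < 1 - w ^+ 2 by rewrite subr_gt0 expr_lt1// ltW.
have [st sw] : 0 < Num.sqrt (1 + t ^+ 2) /\ 0 < Num.sqrt (1 - w ^+ 2).
  by rewrite !sqrtr_gt0.
apply: (@reflection_radius_ge _ r k a b c t w (Num.sqrt (1 + t ^+ 2))^-1
  (Num.sqrt (1 - w ^+ 2))^-1) => //.
- by rewrite nE.
- by rewrite invr_gt0.
- by rewrite exprVn sqr_sqrtr ?(ltW t2)// mulVf// gt_eqF.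
- by rewrite invr_gt0.
- by rewrite exprVn sqr_sqrtr ?(ltW w2)// mulVf// gt_eqF.
- by rewrite -(@ler_pXn2r _ 2) ?nnegrE// ltW.
- have tp : 0 <= (Num.sqrt (1 + t ^+ 2))^-1 * (1 + t).
    by rewrite ltW// mulr_gt0 ?invr_gt0// addr_gt0.
  rewrite -(@ler_pXn2r _ 2) ?nnegrE//.
  rewrite exprMn exprVn sqr_sqrtr ?(ltW t2)//; apply: (le_trans VVJ).
  rewrite le_eqVlt; apply/orP; left; apply/eqP.
  by rewrite VJE /t; field; rewrite !gt_eqF.
- have wp : 0 <= (Num.sqrt (1 - w ^+ 2))^-1 * (1 + w).
    by rewrite ltW// mulr_gt0 ?invr_gt0// addr_gt0.
  rewrite -(@ler_pXn2r _ 2) ?nnegrE//.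
  rewrite exprMn exprVn sqr_sqrtr ?(ltW w2)//; apply: (le_trans VVD).
  rewrite le_eqVlt; apply/orP; left; apply/eqP.
  have -> : 1 - w ^+ 2 = (n + 2 - m) * (n + 2 + m) / (n + 2) ^+ 2.
    by rewrite /w; field; rewrite gt_eqF.
  have nmp : 0 < n + 2 + m by rewrite addr_gt0.
  by rewrite VDE /w; field; rewrite (gt_eqF n20) (gt_eqF n2m0) (gt_eqF nmp).
Qed.

Lemma VJ_le_sqr : (VJ <= r ^+ 2) = (0 <= n ^+ 2 + m ^+ 2 - 2 * m).
Proof.
have -> : r ^+ 2 = 1 + n by rewrite /n; ring.
rewrite VJE lerD2l ler_pdivrMr// -subr_ge0.
have -> : n * (n ^+ 2 + m ^+ 2) - 2 * n * m =
  n * (n ^+ 2 + m ^+ 2 - 2 * m) by ring.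
by rewrite pmulr_rge0.
Qed.

Lemma VD_le_sqr : (VD <= r ^+ 2) = (m <= n).
Proof.
have -> : r ^+ 2 = 1 + n by rewrite /n; ring.
rewrite VDE lerD2l ler_pdivrMr// -subr_ge0.
have -> : n * (n + 2 - m) - 2 * m = (n + 2) * (n - m) by ring.
by rewrite pmulr_rge0 ?subr_ge0// addr_gt0.
Qed.

Let VDJE : VJ - VD =
  2 * m * (2 * n - n * m - m ^+ 2) / ((n ^+ 2 + m ^+ 2) * (n + 2 - m)).
Proof. by rewrite VJE VDE; field; rewrite !gt_eqF. Qed.

Lemma VD_le_VJ : (VD <= VJ) = (m ^+ 2 + n * m <= 2 * n).
Proof.
rewrite -subr_ge0 VDJE pmulr_lge0 ?invr_gt0 ?mulr_gt0// pmulr_rge0 ?mulr_gt0//.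
by rewrite -[RHS]subr_ge0; congr (0 <= _); ring.
Qed.

Lemma VJ_le_VD : (VJ <= VD) = (2 * n <= m ^+ 2 + n * m).
Proof.
rewrite -subr_le0 VDJE pmulr_lle0 ?invr_gt0 ?mulr_gt0// pmulr_rle0 ?mulr_gt0//.
by rewrite -[RHS]subr_le0; congr (_ <= 0); ring.
Qed.

Let r_sqrt2 : (r < Num.sqrt 2) = (n < 1).
Proof.
have -> : (r < Num.sqrt 2) = (Num.sqrt (r ^+ 2) < Num.sqrt 2).
  by rewrite sqrtr_sqr gtr0_norm.
by rewrite ltr_sqrt// /n ltrBlDr.
Qed.

Let h := Num.sqrt (r ^+ 4 + 6 * r ^+ 2 - 7).

Let h0 : 0 <= h. Proof. exact: sqrtr_ge0. Qed.

Let hE : h ^+ 2 = n ^+ 2 + 8 * n.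
Proof.
have e : r ^+ 4 + 6 * r ^+ 2 - 7 = n ^+ 2 + 8 * n by rewrite /n; ring.
by rewrite sqr_sqrtr e// addr_ge0 ?sqr_ge0// mulr_ge0// ltW.
Qed.

(** Completing the square turns [m^2 + n m = 2 n] into [(n + 2 m)^2 = n^2 + 8 n = h^2], which is
    where the inner square root of the tail comes from. *)
Let tailE : neg_cos_Psi_tail r = k + (h - (n + 2 * m)) / (4 * r).
Proof.
by rewrite /neg_cos_Psi_tail -/h /n /m; field; rewrite gt_eqF.
Qed.

Let tail_le : (neg_cos_Psi_tail r <= k) = (2 * n <= m ^+ 2 + n * m).
Proof.
rewrite tailE gerDl pmulr_lle0 ?invr_gt0 ?mulr_gt0// subr_le0.
have nm : 0 <= n + 2 * m by have := n0; have := m0; lra.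
rewrite -(@ler_pXn2r _ 2) ?nnegrE//.
by rewrite hE; apply/idP/idP; have := n0; lra.
Qed.

Let tail_ge : (k <= neg_cos_Psi_tail r) = (m ^+ 2 + n * m <= 2 * n).
Proof.
rewrite tailE lerDl pmulr_lge0 ?invr_gt0 ?mulr_gt0// subr_ge0.
have nm : 0 <= n + 2 * m by have := n0; have := m0; lra.
rewrite -(@ler_pXn2r _ 2) ?nnegrE//.
by rewrite hE; apply/idP/idP; have := n0; lra.
Qed.

Let k_le_head : (k <= 2^-1 * (r - r^-1)) = (m <= n).
Proof.
have -> : 2^-1 * (r - r^-1) = k + (n - m) / (2 * r).
  by rewrite /n /m; field; rewrite gt_eqF.
by rewrite lerDl pmulr_lge0 ?invr_gt0 ?mulr_gt0// subr_ge0.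
Qed.

(** For [n < 1] the circle [n^2 + m^2 = 2 m] reads [(m - 1)^2 = 1 - n^2 = q^2]; its upper half
    [m = 1 + q] is the first branch of [Psi2]. *)
Let q := r * Num.sqrt (2 - r ^+ 2).

Let q0 : 0 <= q. Proof. by rewrite mulr_ge0 ?sqrtr_ge0// ltW. Qed.

Let qE : n < 1 -> q ^+ 2 = 1 - n ^+ 2.
Proof.
move=> n1; rewrite exprMn sqr_sqrtr; first by rewrite /n; ring.
by rewrite subr_ge0 -lerBlDr ltW.
Qed.

Let head_le_k : (2^-1 * (r^-1 + Num.sqrt (2 - r ^+ 2)) <= k) = (1 + q <= m).
Proof.
have -> : 2^-1 * (r^-1 + Num.sqrt (2 - r ^+ 2)) = k + (1 + q - m) / (2 * r).
  by rewrite /q /m; field; rewrite gt_eqF.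
by rewrite gerDl pmulr_lle0 ?invr_gt0 ?mulr_gt0// subr_le0.
Qed.

Lemma diagonal_bisector_optimal :
  k <= neg_cos_Psi1 r -> VD <= r ^+ 2 /\ VD <= VJ.
Proof.
have n_gt0 := n0; have m_gt0 := m0; have q_ge0 := q0.
rewrite /neg_cos_Psi1 r_sqrt2 VD_le_sqr VD_le_VJ; case: (ltP n 1) => n1.
  rewrite k_le_head => mn; split => //.
  have e1 : 0 <= (1 - n) * n by apply: mulr_ge0; lra.
  have e2 : m * m <= n * n by apply: ler_pM; lra.
  have e3 : n * m <= n * n by rewrite ler_pM2l.
  by rewrite expr2; lra.
rewrite tail_ge => le; split => //.
rewrite leNgt; apply/negP => nm.
have e1 : 0 <= (n - 1) * n by apply: mulr_ge0; lra.
have e2 : n * n < m * m by apply: ltr_pM; lra.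
have e3 : n * n < n * m by rewrite ltr_pM2l.
by rewrite expr2 in le; lra.
Qed.

Lemma john_axis_optimal :
  neg_cos_Psi2 r <= k -> VJ <= r ^+ 2 /\ VJ <= VD.
Proof.
have n_gt0 := n0; have m_gt0 := m0; have q_ge0 := q0.
rewrite /neg_cos_Psi2 r_sqrt2 VJ_le_sqr VJ_le_VD; case: (ltP n 1) => n1.
  rewrite head_le_k => qm.
  have e0 : q ^+ 2 <= (m - 1) ^+ 2.
    rewrite ler_pXn2r// ?nnegrE; lra.
  rewrite qE// in e0; split; first by move: e0; rewrite sqrrB; lra.
  have m1 : 1 <= m by lra.
  have e1 : m <= m * m by rewrite ler_peMl// ltW.
  have e2 : n <= n * m by rewrite ler_peMr// ltW.
  by rewrite expr2; lra.
rewrite tail_le => le; split => //.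
have := sqr_ge0 (m - 1); have : 1 <= n * n by rewrite -[1]mulr1 ler_pM.
by rewrite sqrrB; lra.
Qed.

Lemma edge_bisector_optimal :
  neg_cos_Psi1 r < k -> k < neg_cos_Psi2 r -> r ^+ 2 <= VJ /\ r ^+ 2 <= VD.
Proof.
have n_gt0 := n0; have m_gt0 := m0; have q_ge0 := q0.
rewrite /neg_cos_Psi1 /neg_cos_Psi2 r_sqrt2; case: (ltP n 1) => n1; last first.
  (* For [r >= sqrt 2] both thresholds are the common tail, so no [k] lies strictly between them. *)
  by move=> h1 h2; have := lt_trans h1 h2; rewrite ltxx.
rewrite !ltNge k_le_head head_le_k -!ltNge => nm mq.
split; apply: ltW; rewrite ltNge ?VJ_le_sqr ?VD_le_sqr -?ltNge//.
have e0 : `|m - 1| < q.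
  rewrite ltr_norml; apply/andP; split; last by lra.
  (* The point has to lie inside the circle, and [m < 1 + q] excludes only the part above it. The
     part below, [m <= 1 - q], is excluded by [m > n], since [1 - q <= n]. *)
  suff : 1 - n <= q by lra.
  rewrite -(@ler_pXn2r _ 2) ?nnegrE//; last by lra.
  rewrite qE//.
  have : 0 <= n * (1 - n) by apply: mulr_ge0; lra.
  by rewrite sqrrB; lra.
have : `|m - 1| ^+ 2 < q ^+ 2 by rewrite ltr_pXn2r// nnegrE.
by rewrite real_normK ?num_real// qE// sqrrB; lra.
Qed.

End Values.

(** The squared norm of the distinguished triple is one of the three values, and the region makes it
    the least of them, so it bounds the norm of every other triple. The normal form [kappa > 0],
    [l2 < l1] is reached by changing the signs of [kappa] and [a] together, and by exchanging the
    lengths while replacing [(b, c)] by [(- c, - b)]. *)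
Lemma reflection_triple_optimal (R : realType)
    (l1 l2 kappa a0 b0 c0 a b c : R) :
  let r := Num.max l1 l2 / Num.min l1 l2 in
  0 < l1 -> 0 < l2 -> l1 != l2 -> 0 < `|kappa| < 1 ->
  reflection_triple l1 l2 kappa a0 b0 c0 ->
  reflection_triple l1 l2 kappa a b c ->
  [\/ [/\ a0 = 0, neg_cos_Psi1 r < `|kappa| & `|kappa| < neg_cos_Psi2 r],
      c0 = - b0 /\ `|kappa| <= neg_cos_Psi1 r
    | c0 = b0 /\ neg_cos_Psi2 r <= `|kappa| ] ->
  `|a0| + Num.max `|b0| `|c0| <= `|a| + Num.max `|b| `|c|.
Proof.
move=> r l10 l20 l12 kB.
wlog kp : kappa a0 a kB / 0 < kappa.
  move=> H; have := kB; rewrite normr_gt0 => /andP[kN0 _].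
  have [|kn|k0] := ltgtP 0 kappa; first exact: H; last first.
    by rewrite k0 eqxx in kN0.
  move=> [Q0 L0] [Q L] C.
  rewrite -(normrN a0) -(normrN a); apply: (H (- kappa)).
  - by rewrite normrN.
  - by rewrite oppr_gt0.
  - by split; [rewrite sqrrN | rewrite L0; ring].
  - by split; [rewrite sqrrN | rewrite L; ring].
  - by rewrite normrN; case: C => [[-> ? ?]|?|?];
      [apply: Or31; rewrite oppr0|apply: Or32|apply: Or33].
rewrite (gtr0_norm kp) in kB *.
wlog l21 : l1 l2 @r l10 l20 l12 b0 c0 b c / l2 < l1.
  move=> H; have [ll|ll|ll] := ltgtP l2 l1; first exact: H; last first.
    by rewrite ll eqxx in l12.
  rewrite -(normrN b0) -(normrN c0) -(normrN b) -(normrN c).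
  rewrite [Num.max `|- b0| _]maxC [Num.max `|- b| _]maxC.
  move=> [Q0 L0] [Q L] C.
  apply: (H l2 l1) => //.
  - by rewrite eq_sym.
  - split; first by rewrite -Q0; ring.
    by transitivity (2 * l1 * l2 * kappa * a0); [rewrite -L0|]; ring.
  - split; first by rewrite -Q; ring.
    by transitivity (2 * l1 * l2 * kappa * a); [rewrite -L|]; ring.
  - rewrite (maxC l2) (minC l2) -/r.
    by case: C => [?|[-> ?]|[-> ?]];
      [apply: Or31|apply: Or32; rewrite !opprK|apply: Or33].
have rE : r = l1 / l2 by rewrite /r (max_idPl (ltW l21)) (min_idPr (ltW l21)).
have r1 : 1 < r by rewrite rE ltr_pdivlMr// mul1r.
have trip x y z : reflection_triple l1 l2 kappa x y z ->
    x ^+ 2 + y * z = 1 /\ r * y - z / r = 2 * kappa * x.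
  move=> [Q L]; split => //.
  have h : l1 * l2 != 0 by rewrite gt_eqF// mulr_gt0.
  apply: (mulfI h); transitivity (2 * l1 * l2 * kappa * x); last by ring.
  by rewrite -L rE; field; rewrite !gt_eqF.
move=> /trip[Q0 L0] /trip[Q L] C.
suff [? ? ?] : [/\ (`|a0| + Num.max `|b0| `|c0|) ^+ 2 <= r ^+ 2,
    (`|a0| + Num.max `|b0| `|c0|) ^+ 2 <= john_axis_sqr_radius r kappa &
    (`|a0| + Num.max `|b0| `|c0|) ^+ 2 <= diagonal_bisector_sqr_radius r kappa].
  apply: (reflection_radius_sqr_ge r1 kB Q L) => //.
case: C => [[a00 h1 h2]|[cb hk]|[cb hk]].
- have [? ?] := edge_bisector_optimal r1 kB h1 h2.
  rewrite a00 normr0 add0r (radius_edge_bisector r1)//.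
    by rewrite -Q0 a00; ring.
  by rewrite L0 a00 mulr0.
- have [? ?] := diagonal_bisector_optimal r1 kB hk.
  rewrite cb normrN maxxx (radius_diagonal_bisector r1 kB)//.
    by rewrite -Q0 cb; ring.
  by rewrite -L0 cb; ring.
- have [? ?] := john_axis_optimal r1 kB hk.
  rewrite cb maxxx (radius_john_axis r1 kB)//.
    by rewrite -Q0 cb; ring.
  by rewrite -L0 cb; ring.
Qed.

(** * Reflections and circumradii *)

Ltac unfold_coordinates := rewrite /dot /det2 /= /GRing.scale /=.

Section Reflection.
Context {R : realType}.
Implicit Types u v w x y : R * R.

Definition reflect_vector w x : R * R :=
  (2 * dot x w / dot w w) *: w - x.

Lemma dot_gt0 w : w != 0 -> 0 < dot w w.
Proof.
case: w => x y; rewrite /dot /= => w0.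
rewrite lt0r -!expr2 addr_ge0 ?sqr_ge0// andbT.
by rewrite paddr_eq0 ?sqr_ge0// !sqrf_eq0.
Qed.

Lemma proj_line o w x : w != 0 ->
  Defs.proj (line o w) x = o + (dot (x - o) w / dot w w) *: w.
Proof.
move=> w0; have ww := dot_gt0 w0.
apply: get_unique.
  split; first by exists (dot (x - o) w / dot w w).
  move=> z [t _ <-]; move: ww; unfold_coordinates => ww.
  by field; rewrite gt_eqF.
move=> y [[t _ <-] h].
have := h (o + (t + 1) *: w) (ex_intro2 _ _ (t + 1) I erefl).
move: ww; unfold_coordinates => ww e.
congr (_ + _ *: _).
apply: (mulIf (lt0r_neq0 ww)); rewrite divfK ?lt0r_neq0//.
by apply/eqP; rewrite -subr_eq0 -oppr_eq0; apply/eqP; rewrite -e; ring.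
Qed.

Lemma reflection_line o w x : w != 0 ->
  reflection (line o w) x = o + reflect_vector w (x - o).
Proof.
move=> w0; rewrite /reflection proj_line// /reflect_vector.
by apply: injective_projections; unfold_coordinates; ring.
Qed.

Lemma reflect_vectorD w x y :
  reflect_vector w (x + y) = reflect_vector w x + reflect_vector w y.
Proof.
rewrite /reflect_vector.
by apply: injective_projections; unfold_coordinates; ring.
Qed.

Lemma reflect_vectorZ w (t : R) x :
  reflect_vector w (t *: x) = t *: reflect_vector w x.
Proof.
rewrite /reflect_vector.
by apply: injective_projections; unfold_coordinates; ring.
Qed.

(** The images of the sides are the columns. A reflection has eigenvalues 1 and -1, hence trace 0,
    so one parameter serves both diagonal entries. *)
Definition reflection_matrix u v w (a b c : R) : Prop :=
  reflect_vector w u = a *: u + c *: v /\ reflect_vector w v = b *: u - a *: v.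

Lemma basis_inj u v (s t s' t' : R) : det2 u v != 0 ->
  s *: u + t *: v = s' *: u + t' *: v -> s = s' /\ t = t'.
Proof.
move=> D [e1 e2]; rewrite /= in e1 e2.
split; apply: (mulIf D); rewrite /det2.
  have -> : s * (u.1 * v.2 - u.2 * v.1) =
      (s *: u.1 + t *: v.1) * v.2 - (s *: u.2 + t *: v.2) * v.1.
    by unfold_coordinates; ring.
  by rewrite e1 e2 /GRing.scale /=; ring.
have -> : t * (u.1 * v.2 - u.2 * v.1) =
    (s *: u.2 + t *: v.2) * u.1 - (s *: u.1 + t *: v.1) * u.2.
  by unfold_coordinates; ring.
by rewrite e1 e2 /GRing.scale /=; ring.
Qed.

Lemma reflection_matrix_ex u v w : det2 u v != 0 -> w != 0 ->
  exists a b c, reflection_matrix u v w a b c.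
Proof.
move=> D w0; have := dot_gt0 w0; rewrite /dot => ww.
exists (det2 (reflect_vector w u) v / det2 u v),
  (det2 (reflect_vector w v) v / det2 u v),
  (det2 u (reflect_vector w u) / det2 u v).
move: D; rewrite /det2 => D.
by split; rewrite /reflect_vector; apply: injective_projections;
  unfold_coordinates; field; rewrite D gt_eqF.
Qed.

(** The first equation holds because a reflection is an involution, the second because it is
    self-adjoint for the dot product, tested on [u] and [v]. *)
Lemma reflection_matrix_triple u v w (a b c : R) : det2 u v != 0 -> w != 0 ->
  reflection_matrix u v w a b c ->
  a ^+ 2 + b * c = 1 /\ dot u u * b - dot v v * c = 2 * dot u v * a.
Proof.
move=> D w0 [eu ev]; have ww := dot_gt0 w0.
have S2 x : reflect_vector w (reflect_vector w x) = x.
  rewrite /reflect_vector; move: ww; rewrite /dot => ww.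
  by apply: injective_projections; unfold_coordinates; field; rewrite gt_eqF.
have Ssym x y : dot (reflect_vector w x) y = dot x (reflect_vector w y).
  rewrite /reflect_vector; move: ww; rewrite /dot => ww.
  by unfold_coordinates; field; rewrite gt_eqF.
split.
  have e : (a ^+ 2 + b * c) *: u + 0 *: v = 1 *: u + 0 *: v.
    rewrite scale0r scale1r !addr0 -[RHS]S2 eu reflect_vectorD.
    rewrite !reflect_vectorZ eu ev.
    by apply: injective_projections; unfold_coordinates; ring.
  by have [] := basis_inj D e.
have := Ssym u v; rewrite eu ev => h.
by move: h; unfold_coordinates => h; lra.
Qed.

End Reflection.

(** * Circumradius of a parallelogram with respect to its mirror image *)

Section Circumradius.
Context {R : realType} (P : parallelogram R).
Let K := body P.
Let u := side1 P.
Let v := side2 P.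

Let m := corner P + 2^-1 *: (u + v).

Lemma body_centered x : K x <-> exists s t : R,
  [/\ `|s| <= 2^-1, `|t| <= 2^-1 & x = m + (s *: u + t *: v)].
Proof.
split=> [[s [t [s01 t01 ->]]]|[s [t [s2 t2 ->]]]].
  exists (s - 2^-1), (t - 2^-1); split.
  - by move: s01 => /andP[? ?]; rewrite ler_norml; apply/andP; split; lra.
  - by move: t01 => /andP[? ?]; rewrite ler_norml; apply/andP; split; lra.
  - by rewrite /m; apply: injective_projections; unfold_coordinates; field.
exists (s + 2^-1), (t + 2^-1); split.
- by move: s2; rewrite ler_norml => /andP[? ?]; apply/andP; split; lra.
- by move: t2; rewrite ler_norml => /andP[? ?]; apply/andP; split; lra.
- by rewrite /m; apply: injective_projections; unfold_coordinates; field.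
Qed.

Lemma circumradius_reflection o w (a b c : R) : w != 0 ->
  reflection_matrix u v w a b c ->
  circumradius K (reflection (line o w) @` K) = `|a| + Num.max `|b| `|c|.
Proof.
move=> w0 M; have D := Defs.nondegenerate P.
have [Q _] := reflection_matrix_triple D w0 M; have [eu ev] := M.
set F := `|a| + _.
have F0 : 0 < F.
  rewrite lt0r addr_ge0 ?le_max ?normr_ge0// andbT.
  rewrite paddr_eq0 ?le_max ?normr_ge0//.
  apply/negP => /andP[]; rewrite normr_eq0 => /eqP a0 /eqP bc0.
  have : `|b| <= 0 by rewrite -bc0 le_max lexx.
  rewrite normr_le0 => /eqP b0.
  by move: Q; rewrite a0 b0 expr0n mul0r addr0 => /eqP; rewrite eq_sym oner_eq0.
have img (s t : R) : reflection (line o w) (m + (s *: u + t *: v)) =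
    reflection (line o w) m + ((s * a + t * b) *: u + (s * c - t * a) *: v).
  rewrite !reflection_line// (addrAC m) (reflect_vectorD w (m - o)).
  rewrite (reflect_vectorD w (s *: u)) !reflect_vectorZ eu ev.
  by apply: injective_projections; unfold_coordinates; ring.
have mem y : K y -> exists s t : R, [/\ `|s| <= 2^-1, `|t| <= 2^-1 &
    reflection (line o w) y = reflection (line o w) m +
      ((s * a + t * b) *: u + (s * c - t * a) *: v)].
  move=> /body_centered[s [t [hs ht ->]]]; exists s, t; split => //; exact: img.
have memI (s t : R) : `|s| <= 2^-1 -> `|t| <= 2^-1 ->
    (reflection (line o w) @` K)
      (reflection (line o w) m +
        ((s * a + t * b) *: u + (s * c - t * a) *: v)).
  move=> hs ht; exists (m + (s *: u + t *: v)).
    by apply/body_centered; exists s, t.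
  exact: img.
rewrite /circumradius.
(* The admissible factors form the closed ray from [F], so the infimum can be read off. The
   positivity of [F] makes the condition [0 < lambda] automatic on this ray. *)
have -> : [set lambda : R | 0 < lambda /\ exists z : R * R,
    K `<=` [set z + lambda *: c0 | c0 in reflection (line o w) @` K]] =
    [set` `[F, +oo[%R].
  apply/seteqP; split => l /=; rewrite in_itv /= andbT; last first.
    move=> Fl; have l0 : 0 < l by apply: lt_le_trans Fl.
    split=> //; exists (m - l *: reflection (line o w) m).
    move=> x /body_centered[s [t [hs ht ->]]].
    (* Preimage of [(s, t)] under [l] times the matrix, which is its own inverse. *)
    pose s' := (a * s + b * t) / l; pose t' := (c * s - a * t) / l.
    have bnd (p q : R) : `|p| + `|q| <= F -> `|(p * s + q * t) / l| <= 2^-1.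
      move=> pq; rewrite normrM normfV (gtr0_norm l0) ler_pdivrMr//.
      apply: (le_trans (ler_normD _ _)); rewrite !normrM.
      apply: (@le_trans _ _ (`|p| * 2^-1 + `|q| * 2^-1)).
        by rewrite lerD// ler_wpM2l.
      by rewrite -mulrDl mulrC ler_pM2l// (le_trans pq).
    have hs' : `|s'| <= 2^-1 by apply: bnd; rewrite lerD2l le_max lexx.
    have ht' : `|t'| <= 2^-1.
      rewrite /t' -mulNr; apply: bnd.
      by rewrite normrN addrC lerD2l le_max lexx orbT.
    exists (reflection (line o w) m +
      ((s' * a + t' * b) *: u + (s' * c - t' * a) *: v)); first exact: memI.
    have e1 : s' * a + t' * b = s / l.
      have -> : s / l = s * (a ^+ 2 + b * c) / l by rewrite Q mulr1.
      by rewrite /s' /t'; field; rewrite gt_eqF.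
    have e2 : s' * c - t' * a = t / l.
      have -> : t / l = t * (a ^+ 2 + b * c) / l by rewrite Q mulr1.
      by rewrite /s' /t'; field; rewrite gt_eqF.
    rewrite e1 e2; apply: injective_projections; unfold_coordinates.
      by field; rewrite gt_eqF.
    by field; rewrite gt_eqF.
  move=> [l0 [z h]].
  have half : `|2^-1 : R| <= 2^-1 by rewrite ger0_norm.
  have halfN : `|- 2^-1 : R| <= 2^-1 by rewrite normrN.
  (* Two opposite vertices of [K] differ by a vector [Phi y] with [y] in
     [l (K - K)]; apply the reflection once more. *)
  have vert (p q : R) : `|p| <= 2^-1 -> `|q| <= 2^-1 ->
      `|2 * (a * p + b * q)| <= l /\ `|2 * (c * p - a * q)| <= l.
    move=> hp hq.
    have h1 : K (m + (p *: u + q *: v)) by apply/body_centered; exists p, q.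
    have h2 : K (m + (- p *: u + - q *: v)).
      by apply/body_centered; exists (- p), (- q); rewrite !normrN.
    have [_ [y1 /mem[s1 [t1 [hs1 ht1 ->]]] <-] e1] := h _ h1.
    have [_ [y2 /mem[s2 [t2 [hs2 ht2 ->]]] <-] e2] := h _ h2.
    pose s := s1 - s2; pose t := t1 - t2.
    have e : (2 * p) *: u + (2 * q) *: v =
        (l * (s * a + t * b)) *: u + (l * (s * c - t * a)) *: v.
      have -> : (2 * p) *: u + (2 * q) *: v =
          m + (p *: u + q *: v) - (m + (- p *: u + - q *: v)).
        by apply: injective_projections; unfold_coordinates; ring.
      rewrite -e1 -e2 /s /t.
      by apply: injective_projections; unfold_coordinates; ring.
    have [ep eq] := basis_inj D e.
    have -> : 2 * (a * p + b * q) = l * s.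
      transitivity (a * (2 * p) + b * (2 * q)); first by ring.
      rewrite ep eq; transitivity (l * s * (a ^+ 2 + b * c)); first by ring.
      by rewrite Q mulr1.
    have -> : 2 * (c * p - a * q) = l * t.
      transitivity (c * (2 * p) - a * (2 * q)); first by ring.
      rewrite ep eq; transitivity (l * t * (a ^+ 2 + b * c)); first by ring.
      by rewrite Q mulr1.
    have bnd (x y : R) : `|x| <= 2^-1 -> `|y| <= 2^-1 -> `|l * (x - y)| <= l.
      move=> hx hy; rewrite normrM (gtr0_norm l0) ler_piMr ?(ltW l0)//.
      by apply: (le_trans (ler_normB _ _)); lra.
    by split; apply: bnd.
  (* Two adjacent vertices suffice: they give both relative signs of the entries in each row, hence
     both absolute row sums. *)
  have [A1 A2] := vert _ _ half half.
  have [B1 B2] := vert _ _ half halfN.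
  move: A1 A2 B1 B2; rewrite !ler_norml.
  move=> /andP[? ?] /andP[? ?] /andP[? ?] /andP[? ?].
  rewrite /F -lerBrDl ge_max !lerBrDl.
  have nrm (x y : R) : x + y <= l -> x - y <= l -> - x + y <= l ->
      - x - y <= l -> `|x| + `|y| <= l.
    by case: (ler0P x) => _; case: (ler0P y) => _.
  by apply/andP; split; apply: nrm; lra.
by rewrite inf_itv.
Qed.

Lemma chirality_attained o w (a b c : R) : w != 0 ->
  reflection_matrix u v w a b c ->
  (forall w' (a' b' c' : R), w' != 0 -> reflection_matrix u v w' a' b' c' ->
     `|a| + Num.max `|b| `|c| <= `|a'| + Num.max `|b'| `|c'|) ->
  minkowski_chirality1 K = circumradius K (reflection (line o w) @` K).
Proof.
move=> w0 M h; rewrite (circumradius_reflection o w0 M) /minkowski_chirality1.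
set S := (X in inf X); set F := `|a| + _.
have SF : S F.
  exists (line o w); first by exists o, w.
  by rewrite (circumradius_reflection o w0 M).
have lbF : lbound S F.
  move=> _ [_ [p1 [w' [w'_neq0 ->]]] <-].
  have [a' [b' [c' M']]] := reflection_matrix_ex (Defs.nondegenerate P) w'_neq0.
  by rewrite (circumradius_reflection p1 w'_neq0 M'); apply: h M'.
apply/eqP; rewrite eq_le; apply/andP; split.
  by apply: ge_inf => //; exists F.
by apply: lb_le_inf => //; exists F.
Qed.

End Circumradius.

(** * Areas of ellipses *)

Section Area.
Context {R : realType}.
Local Notation mu := (@lebesgue_measure R).

(** Length of the chord of the unit disc at abscissa [s]. For [|s| > 1] it is 0, because [Num.sqrt]
    vanishes on negative numbers, so it can be integrated over the whole line. *)
Definition unit_chord (s : R) : R := 2 * Num.sqrt (1 - s ^+ 2).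

Definition unit_disc_area : R := fine (\int[mu]_s (unit_chord s)%:E)%E.

Lemma lebesgue_measure_itvcc (x y : R) : x <= y ->
  mu `[x, y]%classic = (y - x)%:E.
Proof.
move=> xy; rewrite lebesgue_measure_itv /= lte_fin; case: ltP => [_|yx].
  by rewrite EFinB.
by congr (_%:E); lra.
Qed.

Lemma unit_chord_ge0 s : 0 <= unit_chord s.
Proof. by rewrite mulr_ge0// sqrtr_ge0. Qed.

Lemma continuous_unit_chord : continuous unit_chord.
Proof.
move=> s; rewrite /unit_chord; apply: cvgM; first exact: cvg_cst.
apply: (@continuous_comp _ _ _ (fun s : R => 1 - s ^+ 2) Num.sqrt); last first.
  exact: sqrt_continuous.
by apply: cvgB; [exact: cvg_cst|exact: exprn_continuous].
Qed.

Lemma measurable_unit_chord : measurable_fun [set: R] (EFin \o unit_chord).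
Proof.
apply/measurable_EFinP.
exact: continuous_measurable_fun continuous_unit_chord.
Qed.

Lemma unit_chord_itv_le s :
  \1_(`[- 2^-1, 2^-1]%classic : set R) s <= unit_chord s.
Proof.
rewrite indicE; case: (boolP (s \in _)) => /= [|_]; last exact: unit_chord_ge0.
rewrite inE /= in_itv /= => /andP[s1 s2].
have : 2^-1 <= Num.sqrt (1 - s ^+ 2).
  rewrite -(@ler_pXn2r _ 2) ?nnegrE ?sqrtr_ge0 ?invr_ge0//.
  rewrite sqr_sqrtr; nra.
by rewrite /unit_chord; lra.
Qed.

Lemma unit_chord_le_itv s :
  unit_chord s <= 2 * \1_(`[- 1, 1]%classic : set R) s.
Proof.
rewrite indicE; case: (boolP (s \in _)) => /= [_|sN].
  rewrite /unit_chord ler_pM2l// -[leRHS]sqrtr1 ler_sqrt//.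
  by rewrite gerBl sqr_ge0.
rewrite mulr0 /unit_chord ler0_sqrtr ?mulr0//.
rewrite leNgt; apply/negP => h; move/negP: sN; apply.
rewrite inE /= in_itv /=; apply/andP; split; nra.
Qed.

Lemma integral_unit_chord :
  (\int[mu]_s (unit_chord s)%:E)%E = unit_disc_area%:E.
Proof.
rewrite fineK// ge0_fin_numE; last first.
  by apply: integral_ge0 => s _; rewrite lee_fin unit_chord_ge0.
have m1 : measurable (`[- 1, 1]%classic : set R) by exact: measurable_itv.
apply: (@le_lt_trans _ _
  (\int[mu]_s (2%:E * (\1_(`[- 1, 1]%classic : set R) s)%:E))%E).
  apply: ge0_le_integral => //.
  - by move=> s _; rewrite lee_fin unit_chord_ge0.
  - exact: measurable_unit_chord.
  - apply: measurable_funeM; apply/measurable_EFinP; exact: measurable_indic.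
  - by move=> s _; rewrite -EFinM lee_fin unit_chord_le_itv.
rewrite ge0_integralZl_EFin//; last first.
  by apply/measurable_EFinP; exact: measurable_indic.
rewrite integral_indic// setIT.
rewrite [X in (_ * X < _)%E]lebesgue_measure_itvcc; last by lra.
by rewrite -EFinM ltry.
Qed.

Lemma unit_disc_area_gt0 : 0 < unit_disc_area.
Proof.
rewrite -lte_fin -integral_unit_chord.
have m1 : measurable (`[- 2^-1, 2^-1]%classic : set R) by exact: measurable_itv.
apply: (@lt_le_trans _ _
  (\int[mu]_s ((\1_(`[- 2^-1, 2^-1]%classic : set R) s)%:E))%E).
  rewrite integral_indic// setIT.
  rewrite [X in (_ < X)%E]lebesgue_measure_itvcc; last by lra.
  by rewrite lte_fin; lra.
apply: ge0_le_integral => //.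
- by apply/measurable_EFinP; exact: measurable_indic.
- exact: measurable_unit_chord.
- by move=> s _; rewrite lee_fin unit_chord_itv_le.
Qed.

(** Integration over vertical sections: completing the square in [p.2] shows that the section at [x]
    has length [G x], a rescaled [unit_chord], and an affine substitution removes the scaling. The
    number [A] is the half-width of the region in the first coordinate. *)
Lemma area_quadratic (q11 q12 q22 c1 c2 : R) :
  0 < q22 -> 0 < q11 * q22 - q12 ^+ 2 ->
  area [set p : R * R | q11 * (p.1 - c1) ^+ 2 +
    2 * q12 * (p.1 - c1) * (p.2 - c2) + q22 * (p.2 - c2) ^+ 2 <= 1] =
  (unit_disc_area / Num.sqrt (q11 * q22 - q12 ^+ 2))%:E.
Proof.
set D := q11 * q22 - q12 ^+ 2 => q0 D0.
set E := [set p | _].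
pose A := Num.sqrt q22 / Num.sqrt D.
have sq : 0 < Num.sqrt q22 by rewrite sqrtr_gt0.
have sD : 0 < Num.sqrt D by rewrite sqrtr_gt0.
have A0 : 0 < A by rewrite divr_gt0.
have A2 : A ^+ 2 = q22 / D by rewrite exprMn exprVn !sqr_sqrtr// ltW.
pose G x : R := unit_chord ((x - c1) / A) / Num.sqrt q22.
have section x : mu (xsection E x) = (G x)%:E.
  pose d := x - c1.
  pose h := Num.sqrt (1 - (d / A) ^+ 2) / Num.sqrt q22.
  pose y0 := c2 - q12 * d / q22.
  have h0 : 0 <= h by rewrite mulr_ge0 ?sqrtr_ge0// invr_ge0 ltW.
  have key y : q11 * d ^+ 2 + 2 * q12 * d * (y - c2) + q22 * (y - c2) ^+ 2 =
      q22 * (y - y0) ^+ 2 + (d / A) ^+ 2.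
    rewrite expr_div_n A2 /y0 /D; field.
    by rewrite -/D !gt_eqF.
  have GE : G x = y0 + h - (y0 - h) by rewrite /G /unit_chord -/d /h; ring.
  have [dA|dA] := leP ((d / A) ^+ 2) 1.
    have -> : xsection E x = `[y0 - h, y0 + h]%classic.
      apply/seteqP; split => y /=; rewrite in_itv /=.
        move/xsectionP; rewrite /E /= -/d key => e.
        have : `|y - y0| <= h.
          rewrite -(@ler_pXn2r _ 2) ?nnegrE// real_normK ?num_real//.
          rewrite /h exprMn exprVn !sqr_sqrtr ?(ltW q0) ?subr_ge0//.
          by rewrite ler_pdivlMr//; lra.
        by rewrite ler_norml => /andP[? ?]; apply/andP; split; lra.
      move=> /andP[y1 y2]; apply/xsectionP; rewrite /E /= -/d key.
      have : `|y - y0| <= h by rewrite ler_norml; apply/andP; split; lra.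
      rewrite -(@ler_pXn2r _ 2) ?nnegrE// real_normK ?num_real//.
      rewrite /h exprMn exprVn !sqr_sqrtr ?(ltW q0) ?subr_ge0//.
      by rewrite ler_pdivlMr//; lra.
    by rewrite lebesgue_measure_itvcc ?GE//; lra.
  have -> : xsection E x = set0.
    apply/seteqP; split => y //= /xsectionP; rewrite /E /= -/d key => e.
    have : 0 <= q22 * (y - y0) ^+ 2 by rewrite mulr_ge0 ?sqr_ge0// ltW.
    by lra.
  rewrite measure0 /G /unit_chord -/d ler0_sqrtr ?mulr0 ?mul0r//.
  by rewrite subr_le0 ltW.
rewrite /area /product_measure1.
transitivity (\int[mu]_x (G x)%:E)%E.
  by apply: eq_integral => x _; rewrite /= section.
pose F (x : R^o) : R^o := (x + c1 / A) * A.
have F'E : (F^`())%classic = cst A.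
  apply/funext => x; rewrite /F derive1E deriveM// deriveD//.
  by rewrite derive_cst scaler0 add0r derive_id derive_cst addr0 scaler1.
rewrite (@increasing_ge0_integration_by_substitutionT _ F G).
- rewrite F'E.
  transitivity (\int[mu]_s ((Num.sqrt D)^-1%:E * (unit_chord s)%:E))%E.
    apply: eq_integral => s _; rewrite -EFinM; congr (_%:E).
    transitivity (G (F s) * A) => //; rewrite /G /F.
    have -> : ((s + c1 / A) * A - c1) / A = s by field; rewrite gt_eqF.
    by rewrite /A; field; rewrite !gt_eqF.
  rewrite ge0_integralZl_EFin//.
  + by rewrite integral_unit_chord -EFinM mulrC.
  + by move=> s _; rewrite lee_fin unit_chord_ge0.
  + exact: measurable_unit_chord.
- by move=> x y xy; rewrite /F ltr_pM2r// ltrD2r.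
- by rewrite F'E => ?; exact: cvg_cst.
- by rewrite F'E; exact: is_cvg_cst.
- by rewrite F'E; exact: is_cvg_cst.
- by move=> x; rewrite /F; apply: derivableM.
- by apply/gt0_cvgMlNy => //; exact: cvg_addrr_Ny.
- by apply/gt0_cvgMly => //; exact: cvg_addrr.
- move=> x; apply: cvgM; last exact: cvg_cst.
  apply: (@continuous_comp _ _ _ (fun x : R => (x - c1) / A) unit_chord);
    last exact: continuous_unit_chord.
  apply: cvgM; last exact: cvg_cst.
  by apply: cvgB; [exact: cvg_id|exact: cvg_cst].
- by move=> x; rewrite /G mulr_ge0 ?unit_chord_ge0// invr_ge0 ltW.
Qed.

End Area.

(** * Ellipses as quadratic regions *)

Section Ellipse.
Context {R : realType}.
Implicit Types (u v w c : R * R) (a b : R).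

Definition orthonormal e1 e2 : Prop :=
  [/\ dot e1 e1 = 1, dot e2 e2 = 1 & dot e1 e2 = 0 :> R].

(** In the plane [e2] is [e1] turned by a right angle, up to the orientation [d], which is the
    determinant of the pair. *)
Lemma orthonormal_rot e1 e2 : orthonormal e1 e2 ->
  exists d : R, d ^+ 2 = 1 /\ e2 = (- d * e1.2, d * e1.1).
Proof.
case: e1 e2 => [x y] [z t]; rewrite /orthonormal /dot /= => -[h1 h2 h3].
have e : (x * t - y * z) ^+ 2 = 1.
  transitivity ((x * x + y * y) * (z * z + t * t) - (x * z + y * t) ^+ 2).
    by ring.
  by rewrite h1 h2 h3; ring.
exists (x * t - y * z); split => //.
congr pair.
  transitivity (z * (x * x + y * y) - x * (x * z + y * t)); last by ring.
  by rewrite h1 h3; ring.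
transitivity (t * (x * x + y * y) - y * (x * z + y * t)); last by ring.
by rewrite h1 h3; ring.
Qed.

Lemma ellipse_quadratic c e1 e2 a b : orthonormal e1 e2 -> 0 < a -> 0 < b ->
  let q11 := (e1.1 / a) ^+ 2 + (e2.1 / b) ^+ 2 in
  let q12 := e1.1 * e1.2 / a ^+ 2 + e2.1 * e2.2 / b ^+ 2 in
  let q22 := (e1.2 / a) ^+ 2 + (e2.2 / b) ^+ 2 in
  ellipse c e1 e2 a b = [set p : R * R | q11 * (p.1 - c.1) ^+ 2 +
    2 * q12 * (p.1 - c.1) * (p.2 - c.2) + q22 * (p.2 - c.2) ^+ 2 <= 1].
Proof.
move=> on a0 b0 q11 q12 q22.
have q p : q11 * (p.1 - c.1) ^+ 2 +
    2 * q12 * (p.1 - c.1) * (p.2 - c.2) + q22 * (p.2 - c.2) ^+ 2 =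
    (dot (p - c) e1 / a) ^+ 2 + (dot (p - c) e2 / b) ^+ 2.
  by rewrite /q11 /q12 /q22 /dot /=; field; rewrite !gt_eqF.
have [n1 n2 n12] := on; have [d [d2 e2E]] := orthonormal_rot on.
have expand (z : R * R) : z = dot z e1 *: e1 + dot z e2 *: e2.
  rewrite e2E; apply: injective_projections; unfold_coordinates.
    transitivity (z.1 * (e1.1 * e1.1 + d ^+ 2 * (e1.2 * e1.2)) +
        z.2 * e1.1 * e1.2 * (1 - d ^+ 2)); last by ring.
    by rewrite d2 subrr mulr0 addr0 mul1r -/(dot e1 e1) n1 mulr1.
  transitivity (z.2 * (d ^+ 2 * (e1.1 * e1.1) + e1.2 * e1.2) +
      z.1 * e1.1 * e1.2 * (1 - d ^+ 2)); last by ring.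
  by rewrite d2 subrr mulr0 addr0 mul1r -/(dot e1 e1) n1 mulr1.
apply/seteqP; split => p /=.
  move=> [x [y [h ->]]]; rewrite q.
  have -> : dot (c + x *: e1 + y *: e2 - c) e1 = x * dot e1 e1 + y * dot e1 e2.
    by unfold_coordinates; ring.
  have -> : dot (c + x *: e1 + y *: e2 - c) e2 = x * dot e1 e2 + y * dot e2 e2.
    by unfold_coordinates; ring.
  by rewrite n1 n2 n12 !mulr0 !mulr1 addr0 add0r.
rewrite q => h; exists (dot (p - c) e1), (dot (p - c) e2); split => //.
by rewrite -addrA -expand addrC subrK.
Qed.

Lemma area_ellipse c e1 e2 a b : orthonormal e1 e2 -> 0 < a -> 0 < b ->
  area (ellipse c e1 e2 a b) = (unit_disc_area * (a * b))%:E.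
Proof.
move=> on a0 b0; have /= := ellipse_quadratic c on a0 b0.
set q11 := (e1.1 / a) ^+ 2 + _; set q12 := e1.1 * e1.2 / a ^+ 2 + _.
set q22 := (e1.2 / a) ^+ 2 + _ => ->.
have [n1 _ _] := on; have [d [d2 e2E]] := orthonormal_rot on.
have D : q11 * q22 - q12 ^+ 2 = (a * b) ^- 2.
  transitivity ((d * (e1.1 * e1.1 + e1.2 * e1.2)) ^+ 2 / (a * b) ^+ 2).
    by rewrite /q11 /q12 /q22 e2E /=; field; rewrite !gt_eqF.
  by rewrite -/(dot e1 e1) n1 mulr1 d2 mul1r.
have ab0 : 0 < a * b by rewrite mulr_gt0.
rewrite area_quadratic ?D ?invr_gt0 ?exprn_gt0//.
  by rewrite -exprVn sqrtr_sqr gtr0_norm ?invr_gt0// invrK.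
rewrite /q22 lt0r addr_ge0 ?sqr_ge0// andbT paddr_eq0 ?sqr_ge0//.
rewrite !sqrf_eq0 !mulf_eq0 !invr_eq0 (gt_eqF a0) (gt_eqF b0) !orbF.
apply/negP => /andP[/eqP y0]; rewrite e2E /= mulf_eq0 => /orP[/eqP z|/eqP z].
  by move: d2; rewrite z expr0n => /eqP; rewrite eq_sym oner_eq0.
by move: n1; rewrite /dot y0 z !mul0r addr0 => /eqP; rewrite eq_sym oner_eq0.
Qed.

End Ellipse.

(** * The John ellipse *)

Section JohnEllipse.
Context {R : realType} (P : parallelogram R).
Let K := body P.
Let u := side1 P.
Let v := side2 P.
Let D := det2 u v.
Let m := corner P + 2^-1 *: (u + v).

Let D0 : D != 0. Proof. exact: Defs.nondegenerate. Qed.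

(** Affine image of the disc inscribed in the square [|s|, |t| <= 1/2] of side coordinates. *)
Definition inellipse : set (R * R) :=
  [set p | exists s t : R,
    s ^+ 2 + t ^+ 2 <= 4^-1 /\ p = m + (s *: u + t *: v)].

Lemma inellipse_sub : inellipse `<=` K.
Proof.
move=> _ [s [t [st ->]]]; apply/body_centered; exists s, t.
have bnd (x y : R) : x ^+ 2 + y ^+ 2 <= 4^-1 -> `|x| <= 2^-1.
  move=> h; rewrite -(@ler_pXn2r _ 2) ?nnegrE ?invr_ge0//.
  rewrite real_normK ?num_real//.
  have := sqr_ge0 y; lra.
by split=> //; [exact: (bnd s t) | apply: (bnd t s); rewrite addrC].
Qed.

Lemma coordinates (z : R * R) : exists s t : R, z = s *: u + t *: v.
Proof.
exists (det2 z v / D), (det2 u z / D).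
have := D0; rewrite /D /det2 => h.
by apply: injective_projections; unfold_coordinates; field.
Qed.

(** Twice the matrix is orthogonal. Its columns will be the side coordinates of the semi-axes; the
    conditions are put on the rows, because each row is bounded by one pair of parallel edges. *)
Definition half_orthogonal (n11 n12 n21 n22 : R) : Prop :=
  [/\ n11 ^+ 2 + n12 ^+ 2 = 4^-1, n21 ^+ 2 + n22 ^+ 2 = 4^-1 &
      n11 * n21 + n12 * n22 = 0].

Lemma half_orthogonal_ellipse e1 e2 (a b n11 n12 n21 n22 : R) :
  0 < a -> 0 < b ->
  half_orthogonal n11 n12 n21 n22 ->
  a *: e1 = n11 *: u + n21 *: v -> b *: e2 = n12 *: u + n22 *: v ->
  ellipse m e1 e2 a b = inellipse.
Proof.
move=> a0 b0 [h1 h2 h3] E1 E2.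
have on : orthonormal ((2 * n11, 2 * n12)) ((2 * n21, 2 * n22)).
  rewrite /orthonormal /dot /=; split.
  - by transitivity (4 * (n11 ^+ 2 + n12 ^+ 2)); [ring|rewrite h1 divff].
  - by transitivity (4 * (n21 ^+ 2 + n22 ^+ 2)); [ring|rewrite h2 divff].
  - by transitivity (4 * (n11 * n21 + n12 * n22)); [ring|rewrite h3 mulr0].
have [d [d2 /= [f1 f2]]] := orthonormal_rot on.
have g1 : n21 = - d * n12 by lra.
have g2 : n22 = d * n11 by lra.
apply/seteqP; split => p.
  move=> [x [y [xy ->]]].
  exists (x / a * n11 + y / b * n12), (x / a * n21 + y / b * n22); split.
    have -> : (x / a * n11 + y / b * n12) ^+ 2 +
       (x / a * n21 + y / b * n22) ^+ 2 =
       ((x / a) ^+ 2 * (n11 ^+ 2 + d ^+ 2 * n12 ^+ 2) +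
        (y / b) ^+ 2 * (n12 ^+ 2 + d ^+ 2 * n11 ^+ 2)) +
        2 * (x / a) * (y / b) * n11 * n12 * (1 - d ^+ 2).
      by rewrite g1 g2; ring.
    rewrite d2 subrr mulr0 addr0 !mul1r (addrC (n12 ^+ 2)) h1 -mulrDl.
    by rewrite ler_piMl.
  rewrite -(addrA m); congr (_ + _).
  transitivity ((x / a) *: (a *: e1) + (y / b) *: (b *: e2)).
    by rewrite !scalerA !divfK ?gt_eqF.
  by rewrite E1 E2; apply: injective_projections; unfold_coordinates; ring.
move=> [s [t [st ->]]].
exists (4 * a * (n11 * s + n21 * t)), (4 * b * (n12 * s + n22 * t)); split.
  have -> : (4 * a * (n11 * s + n21 * t) / a) ^+ 2 +
      (4 * b * (n12 * s + n22 * t) / b) ^+ 2 =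
      16 * (s ^+ 2 * (n11 ^+ 2 + n12 ^+ 2) + t ^+ 2 * (n21 ^+ 2 + n22 ^+ 2) +
      2 * s * t * (n11 * n21 + n12 * n22)).
    by field; rewrite !gt_eqF.
  by rewrite h1 h2 h3; lra.
rewrite -(addrA m); congr (_ + _).
transitivity ((4 * (n11 * s + n21 * t)) *: (a *: e1) +
    (4 * (n12 * s + n22 * t)) *: (b *: e2)); last first.
  by apply: injective_projections; unfold_coordinates; ring.
rewrite E1 E2.
transitivity (
    (4 * (s * (n11 ^+ 2 + n12 ^+ 2) + t * (n11 * n21 + n12 * n22))) *: u +
    (4 * (s * (n11 * n21 + n12 * n22) + t * (n21 ^+ 2 + n22 ^+ 2))) *: v).
  by rewrite h1 h2 h3; apply: injective_projections; unfold_coordinates; field.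
by apply: injective_projections; unfold_coordinates; ring.
Qed.

(* An affine functional of linear part [n] maps the unit disc to an interval of
   half-length [|n|] around its value at the centre. *)
Lemma disc_functional_bound (g n1 n2 : R) :
  (forall x y : R, x ^+ 2 + y ^+ 2 <= 1 -> `|g + (x * n1 + y * n2)| <= 2^-1) ->
  n1 ^+ 2 + n2 ^+ 2 <= 4^-1 /\ (n1 ^+ 2 + n2 ^+ 2 = 4^-1 -> g = 0).
Proof.
move=> h; set N := n1 ^+ 2 + n2 ^+ 2.
have N0 : 0 <= N by rewrite addr_ge0 ?sqr_ge0.
pose L := Num.sqrt N.
have L0 : 0 <= L by rewrite sqrtr_ge0.
have L2 : L ^+ 2 = N by rewrite sqr_sqrtr.
have [Lz|Lz] := eqVneq L 0.
  have -> : N = 0 by rewrite -L2 Lz expr0n.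
  by split; [|move/eqP; rewrite eq_sym invr_eq0 pnatr_eq0].
have e (s : R) : s ^+ 2 = 1 -> `|g + s * L| <= 2^-1.
  move=> s1; have := h (s * n1 / L) (s * n2 / L).
  have -> : (s * n1 / L) ^+ 2 + (s * n2 / L) ^+ 2 = s ^+ 2 * N / L ^+ 2.
    by rewrite /N; field.
  have -> : s * n1 / L * n1 + s * n2 / L * n2 = s * (N / L).
    by rewrite /N; field.
  have -> : N / L = L by rewrite -L2; field.
  by rewrite L2 s1 mul1r divff ?lexx -?L2 ?expf_neq0//; apply.
have eN : (- 1) ^+ 2 = 1 :> R by rewrite sqrrN expr1n.
have := e 1 (expr1n _ _); have := e _ eN; rewrite !ler_norml mulN1r mul1r.
move=> /andP[? ?] /andP[? ?].
have L1 : L <= 2^-1 by lra.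
split; first by rewrite -L2; nra.
move=> N4; have : L = 2^-1; last by lra.
apply/eqP; rewrite -(@eqrXn2 _ 2)// ?invr_ge0// L2 N4.
by apply/eqP; field.
Qed.

(** Containment in [K] bounds both rows of the semi-axis matrix by [1/2] in length, while the last
    hypothesis bounds its determinant below by [1/4] in absolute value. This is equality in
    Hadamard's inequality, so the rows are orthogonal of length [1/2], and there is no room left to
    move the centre. *)
Lemma inscribed_ellipse_maximal c e1 e2 (a b : R) : orthonormal e1 e2 ->
  ellipse c e1 e2 a b `<=` K -> 0 < a -> 0 < b -> `|D| / 4 <= a * b ->
  c = m /\ exists n11 n12 n21 n22, [/\ half_orthogonal n11 n12 n21 n22,
    a *: e1 = n11 *: u + n21 *: v & b *: e2 = n12 *: u + n22 *: v].
Proof.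
move=> on sub a0 b0 big.
have [n11 [n21 E1]] := coordinates (a *: e1).
have [n12 [n22 E2]] := coordinates (b *: e2).
have [g1 [g2 E3]] := coordinates (c - m).
have bnd x y : x ^+ 2 + y ^+ 2 <= 1 ->
    `|g1 + (x * n11 + y * n12)| <= 2^-1 /\ `|g2 + (x * n21 + y * n22)| <= 2^-1.
  move=> xy.
  have /sub/body_centered[s [t [hs ht e]]] :
      ellipse c e1 e2 a b (c + (x * a) *: e1 + (y * b) *: e2).
    by exists (x * a), (y * b); rewrite !mulfK ?gt_eqF.
  have : (g1 + (x * n11 + y * n12)) *: u + (g2 + (x * n21 + y * n22)) *: v =
      s *: u + t *: v.
    transitivity ((c - m) + x *: (a *: e1) + y *: (b *: e2)).
      rewrite E1 E2 E3.
      by apply: injective_projections; unfold_coordinates; ring.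
    rewrite !scalerA (addrAC c) (addrAC _ (- m)) e.
    by rewrite addrC addKr.
  by move=> /(basis_inj D0)[-> ->].
have [N1 G1] := disc_functional_bound (fun x y h => (bnd x y h).1).
have [N2 G2] := disc_functional_bound (fun x y h => (bnd x y h).2).
have [d [d2 e2E]] := orthonormal_rot on.
have [nn _ _] := on.
have det : (n11 * n22 - n12 * n21) ^+ 2 * D ^+ 2 = (a * b) ^+ 2.
  transitivity (det2 (a *: e1) (b *: e2) ^+ 2).
    by rewrite E1 E2 /D; unfold_coordinates; ring.
  transitivity ((a * b) ^+ 2 * d ^+ 2 * (dot e1 e1) ^+ 2).
    by rewrite e2E; unfold_coordinates; ring.
  by rewrite d2 nn expr1n !mulr1.
have big2 : D ^+ 2 * 16^-1 <= (a * b) ^+ 2.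
  have -> : D ^+ 2 * 16^-1 = (`|D| / 4) ^+ 2.
    by rewrite expr_div_n real_normK ?num_real//; field.
  by rewrite ler_pXn2r// nnegrE ?divr_ge0// mulr_ge0// ltW.
have Dp : 0 < D ^+ 2 by rewrite exprn_even_gt0.
have det16 : 16^-1 <= (n11 * n22 - n12 * n21) ^+ 2.
  by rewrite -(ler_pM2r Dp) mulrC det.
(* Lagrange's identity, with left side at least [1/16] and right side at most [1/4 * 1/4]. *)
have lag : (n11 * n22 - n12 * n21) ^+ 2 + (n11 * n21 + n12 * n22) ^+ 2 =
    (n11 ^+ 2 + n12 ^+ 2) * (n21 ^+ 2 + n22 ^+ 2) by ring.
have N10 : 0 <= n11 ^+ 2 + n12 ^+ 2 by rewrite addr_ge0 ?sqr_ge0.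
have N20 : 0 <= n21 ^+ 2 + n22 ^+ 2 by rewrite addr_ge0 ?sqr_ge0.
have dp := sqr_ge0 (n11 * n21 + n12 * n22).
have [M1 M2] : n11 ^+ 2 + n12 ^+ 2 = 4^-1 /\ n21 ^+ 2 + n22 ^+ 2 = 4^-1.
  move: lag N1 N2 N10 N20; set p := n11 ^+ 2 + _; set q := n21 ^+ 2 + _.
  by move=> ? ? ? ? ?; split; nra.
have M3 : n11 * n21 + n12 * n22 = 0.
  apply/eqP; rewrite -sqrf_eq0; apply/eqP; move: lag; rewrite M1 M2; lra.
split.
  have : c - m = 0 by rewrite E3 (G1 M1) (G2 M2) !scale0r addr0.
  by move/eqP; rewrite subr_eq0 => /eqP.
by exists n11, n12, n21, n22.
Qed.

(** With [p], [q], [g] the Gram entries of [u] and [v], the second equation says that [x u + y v]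
    and [- y u + x v] are orthogonal; they then give the axes of [inellipse]. *)
Lemma diagonalizing_rotation (p q g : R) : exists x y : R,
  x ^+ 2 + y ^+ 2 = 1 /\ x * y * (q - p) + (x ^+ 2 - y ^+ 2) * g = 0.
Proof.
have [->|g0] := eqVneq g 0.
  by exists 1, 0; split; ring.
pose W := Num.sqrt ((q - p) ^+ 2 + 4 * g ^+ 2).
have W2 : W ^+ 2 = (q - p) ^+ 2 + 4 * g ^+ 2.
  by rewrite sqr_sqrtr//; have := sqr_ge0 (q - p); have := sqr_ge0 g; lra.
have g2 : 0 < g ^+ 2 by rewrite exprn_even_gt0.
have W0 : 0 < W by rewrite sqrtr_gt0; have := sqr_ge0 (q - p); lra.
have Wp : 0 < W + (q - p).
  have : (q - p) ^+ 2 < W ^+ 2 by rewrite W2; lra.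
  have := ler_norm (- (q - p)); rewrite normrN => h1.
  rewrite -[X in X < _](real_normK (num_real (q - p))).
  rewrite ltr_pXn2r// ?nnegrE ?(ltW W0)//.
  by lra.
(* [(s + i z) ^ 2] is a positive multiple of [(q - p) - 2 i g]. *)
pose s := W + (q - p); pose z := - 2 * g.
pose N := Num.sqrt (s ^+ 2 + z ^+ 2).
have N0 : 0 < N.
  by rewrite sqrtr_gt0 ltr_wpDr ?sqr_ge0// exprn_gt0.
have N2 : N ^+ 2 = s ^+ 2 + z ^+ 2 by rewrite sqr_sqrtr// addr_ge0 ?sqr_ge0.
exists (s / N), (z / N); split.
  rewrite !expr_div_n -mulrDl N2 divff//.
  by rewrite -N2 expf_neq0// gt_eqF.
transitivity ((s * z * (q - p) + (s ^+ 2 - z ^+ 2) * g) / N ^+ 2).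
  by field; rewrite gt_eqF.
have -> : s * z * (q - p) + (s ^+ 2 - z ^+ 2) * g =
  g * (W ^+ 2 - ((q - p) ^+ 2 + 4 * g ^+ 2)) by rewrite /z /s; ring.
by rewrite W2 subrr mulr0 mul0r.
Qed.

Lemma inellipse_axes : exists e1 e2 (a b : R),
  ellipse_axes inellipse m e1 e2 a b /\ a * b = `|D| / 4.
Proof.
have [x [y [xy h]]] := diagonalizing_rotation (dot u u) (dot v v) (dot u v).
pose X := x *: u + y *: v; pose Y := - y *: u + x *: v.
have XY : dot X Y = 0.
  by rewrite -h /X /Y; unfold_coordinates; ring.
have dXY : det2 X Y = D.
  transitivity ((x ^+ 2 + y ^+ 2) * D); last by rewrite xy mul1r.
  by rewrite /X /Y /D; unfold_coordinates; ring.
have [X0 Y0] : X != 0 /\ Y != 0.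
  split; apply/eqP => e; move: dXY D0; rewrite e /det2 /= ?mul0r ?mulr0 subrr;
    by move=> <-; rewrite eqxx.
pose A := len X; pose B := len Y.
have A0 : 0 < A by rewrite sqrtr_gt0 dot_gt0.
have B0 : 0 < B by rewrite sqrtr_gt0 dot_gt0.
have A2 : A ^+ 2 = dot X X by rewrite sqr_sqrtr// ltW// dot_gt0.
have B2 : B ^+ 2 = dot Y Y by rewrite sqr_sqrtr// ltW// dot_gt0.
exists (A^-1 *: X), (B^-1 *: Y), (A / 2), (B / 2); split.
  split.
  - transitivity (dot X X / A ^+ 2).
      by unfold_coordinates; field; rewrite gt_eqF.
    by rewrite A2 divff// gt_eqF// dot_gt0.
  - transitivity (dot Y Y / B ^+ 2).
      by unfold_coordinates; field; rewrite gt_eqF.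
    by rewrite B2 divff// gt_eqF// dot_gt0.
  - transitivity (dot X Y / (A * B)); last by rewrite XY mul0r.
    by unfold_coordinates; field; rewrite !gt_eqF.
  - by rewrite !divr_gt0.
  - apply/esym.
    apply: (@half_orthogonal_ellipse _ _ _ _ (x / 2) (- y / 2) (y / 2) (x / 2)).
    + by rewrite divr_gt0.
    + by rewrite divr_gt0.
    + split; last by field.
        transitivity ((x ^+ 2 + y ^+ 2) / 4); first by field.
        by rewrite xy mul1r.
      transitivity ((x ^+ 2 + y ^+ 2) / 4); first by field.
      by rewrite xy mul1r.
    + rewrite scalerA /X; apply: injective_projections; unfold_coordinates;
        by field; rewrite gt_eqF.
    + rewrite scalerA /Y; apply: injective_projections; unfold_coordinates;
        by field; rewrite gt_eqF.
have -> : `|D| = A * B.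
  apply/eqP; rewrite -(@eqrXn2 _ 2)// ?mulr_ge0 ?(ltW A0) ?(ltW B0)//.
  rewrite real_normK ?num_real// exprMn A2 B2 -dXY.
  apply/eqP; transitivity (dot X X * dot Y Y - (dot X Y) ^+ 2); last first.
    by rewrite XY expr0n subr0.
  by rewrite /dot /det2; ring.
by field.
Qed.

Lemma area_inellipse : area inellipse = (unit_disc_area * (`|D| / 4))%:E.
Proof.
have [e1 [e2 [a [b [[n1 n2 n12 [a0 b0] ->] <-]]]]] := inellipse_axes.
by rewrite area_ellipse.
Qed.

Lemma john_ellipse_body : john_ellipse K = inellipse.
Proof.
have is_ell : is_ellipse inellipse.
  have [e1 [e2 [a [b [h _]]]]] := inellipse_axes.
  by exists m, e1, e2, a, b.
have lt E : is_ellipse E -> E `<=` K -> E <> inellipse ->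
    (area E < area inellipse)%E.
  move=> [c [e1 [e2 [a [b [n1 n2 n12 [a0 b0] EE]]]]]] sub ne.
  rewrite EE in sub ne *.
  rewrite area_inellipse area_ellipse// lte_fin ltr_pM2l ?unit_disc_area_gt0//.
  rewrite ltNge; apply/negP => big; apply: ne.
  have [|-> [n11 [n12' [n21 [n22 [ho E1 E2]]]]]] :=
    @inscribed_ellipse_maximal c e1 e2 a b _ sub a0 b0 big; first by [].
  exact: half_orthogonal_ellipse ho E1 E2.
apply: get_unique; first by split => //; exact: inellipse_sub.
(* A second maximal ellipse would be both strictly smaller and strictly larger than [inellipse]. *)
move=> E [iE sE hE]; apply: contrapT => ne.
have := hE _ is_ell inellipse_sub (fun e => ne (esym e)).
move=> /(lt_trans (lt E iE sE ne)).
by rewrite ltxx.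
Qed.

(** Any description of the ellipse by axes has maximal area, so its semi-axis matrix is half an
    orthogonal one. The reflection is [diag(1, -1)] in the basis of the semi-axes, and conjugating
    this by an orthogonal matrix yields a symmetric one. *)
Lemma john_axis_reflection U : principal_axis (john_ellipse K) U ->
  exists o w, [/\ w != 0, U = line o w &
    forall a b c, reflection_matrix u v w a b c -> c = b].
Proof.
rewrite john_ellipse_body.
move=> [c0 [e1 [e2 [a [b [[n1 n2 n12 [a0 b0] EE] ->]]]]]].
have e10 : e1 != 0.
  apply/eqP => e; move: n1; rewrite e /dot /= !mul0r addr0 => /eqP.
  by rewrite eq_sym oner_eq0.
exists c0, e1; split => // x y z [M1 M2].
have big : `|D| / 4 <= a * b.
  have := area_inellipse; rewrite {1}EE area_ellipse// => -[].
  by move=> /(mulfI (lt0r_neq0 (@unit_disc_area_gt0 R))) ->.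
have on : orthonormal e1 e2 by [].
have sub : ellipse c0 e1 e2 a b `<=` K by rewrite -EE; exact: inellipse_sub.
have [_ [n11 [n12' [n21 [n22 [[h1 h2 h3] E1 E2]]]]]] :=
  inscribed_ellipse_maximal on sub a0 b0 big.
have S1 : reflect_vector e1 (a *: e1) = a *: e1.
  rewrite reflect_vectorZ; congr (_ *: _).
  rewrite /reflect_vector n1 divr1 mulr1.
  by apply: injective_projections; unfold_coordinates; ring.
have S2 : reflect_vector e1 (b *: e2) = (- b) *: e2.
  rewrite reflect_vectorZ /reflect_vector.
  have -> : dot e2 e1 = 0 by rewrite -n12 /dot; ring.
  by apply: injective_projections; unfold_coordinates; ring.
rewrite scaleNr in S2.
rewrite E1 reflect_vectorD !reflect_vectorZ M1 M2 in S1.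
rewrite E2 reflect_vectorD !reflect_vectorZ M1 M2 in S2.
have [p1 p2] : n11 * x + n21 * y = n11 /\ n11 * z - n21 * x = n21.
  apply: (basis_inj D0); rewrite -S1.
  by apply: injective_projections; unfold_coordinates; ring.
have [p3 p4] : n12' * x + n22 * y = - n12' /\ n12' * z - n22 * x = - n22.
  apply: (basis_inj D0); rewrite !scaleNr -opprD -S2.
  by apply: injective_projections; unfold_coordinates; ring.
have : z * (n11 ^+ 2 + n12' ^+ 2) - y * (n21 ^+ 2 + n22 ^+ 2) =
    2 * x * (n11 * n21 + n12' * n22).
  have f1 : n11 * z = n21 + n21 * x by lra.
  have f2 : n12' * z = - n22 + n22 * x by lra.
  have f3 : n21 * y = n11 - n11 * x by lra.
  have f4 : n22 * y = - n12' - n12' * x by lra.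
  transitivity (n11 * (n11 * z) + n12' * (n12' * z) -
      n21 * (n21 * y) - n22 * (n22 * y)).
    by ring.
  by rewrite f1 f2 f3 f4; ring.
by rewrite h1 h2 h3 mulr0; lra.
Qed.

End JohnEllipse.

(** * Angles *)

Section Angles.
Context {R : realType}.
Implicit Types (u v w a b : R * R).

Lemma ler_acos : {in `[-1, 1] &, {mono @acos R : x y /~ x <= y}}.
Proof.
move=> x y hx hy; rewrite !leNgt; congr (~~ _).
have acosI z : z \in `[-1, 1] -> acos z \in `[0, pi].
  by rewrite !in_itv /= => h; rewrite acos_ge0// acos_lepi.
by rewrite -ltr_cos ?acosI// !acosK.
Qed.

Lemma len_gt0 w : w != 0 -> 0 < len w.
Proof. by move=> w0; rewrite sqrtr_gt0 dot_gt0. Qed.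

Lemma len_sqr w : len w ^+ 2 = dot w w.
Proof. by rewrite sqr_sqrtr// /dot addr_ge0// -expr2 sqr_ge0. Qed.

Lemma lenN w : len (- w) = len w.
Proof. by rewrite /len /dot /= !mulrNN. Qed.

Lemma dotNl a b : dot (- a) b = - dot a b.
Proof. by rewrite /dot /=; ring. Qed.

Lemma cos_angle_sqr a b : a != 0 -> b != 0 ->
  (dot a b / (len a * len b)) ^+ 2 = 1 - (det2 a b / (len a * len b)) ^+ 2.
Proof.
move=> a0 b0; have := len_gt0 a0; have := len_gt0 b0 => lb la.
rewrite !expr_div_n.
have -> : dot a b ^+ 2 = (len a * len b) ^+ 2 - det2 a b ^+ 2.
  by rewrite exprMn !len_sqr /dot /det2; ring.
by rewrite mulrBl divff// expf_neq0// gt_eqF// mulr_gt0.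
Qed.

Lemma cos_angle_itv a b : a != 0 -> b != 0 ->
  dot a b / (len a * len b) \in `[-1, 1].
Proof.
move=> a0 b0; rewrite in_itv /= -ler_norml -(@ler_pXn2r _ 2) ?nnegrE//.
by rewrite real_normK ?num_real// cos_angle_sqr// expr1n gerBl sqr_ge0.
Qed.

(** Recording only that the mirror image of [a] is parallel to [b] makes the condition insensitive
    to signs, so all vertices, and both pairs of vertical angles of the diagonals, lead to the same
    equation. *)
Lemma bisects_reflect U o a b : det2 a b != 0 -> bisects U o a b ->
  exists2 w, w != 0 /\ U = line o w & det2 (reflect_vector w a) b = 0.
Proof.
move=> ab [w [w0 -> aw wb]]; exists w => //.
have a0 : a != 0.
  by apply: contraNneq ab => ->; rewrite /det2 /= !mul0r subrr.
have b0 : b != 0.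
  by apply: contraNneq ab => ->; rewrite /det2 /= !mulr0 subrr.
have [la lb lw] : [/\ 0 < len a, 0 < len b & 0 < len w].
  by split; apply: len_gt0.
have h : dot a w * len b = dot w b * len a.
  have e : dot a w / (len a * len w) = dot w b / (len w * len b).
    rewrite -[LHS](@acosK R) ?cos_angle_itv// -[RHS](@acosK R) ?cos_angle_itv//.
    by congr cos; rewrite -/(angle a w) aw -wb.
  have := congr1 (fun z => z * (len a * len b * len w)) e.
  have -> : dot a w / (len a * len w) * (len a * len b * len w) =
      dot a w * len b.
    by field; rewrite !gt_eqF.
  move=> ->; by field; rewrite !gt_eqF.
have ww := dot_gt0 w0.
(* The rescaled vectors [x], [y] have the same length, so [x + y] is orthogonal
   to [x - y], as [w] is; hence [w] is parallel to [x + y]. *)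
pose x := len b *: a; pose y := len a *: b.
have xy : dot x x = dot y y.
  transitivity (len b ^+ 2 * dot a a).
    by rewrite /x; unfold_coordinates; ring.
  transitivity (len a ^+ 2 * dot b b); last first.
    by rewrite /y; unfold_coordinates; ring.
  by rewrite !len_sqr mulrC.
have dw : dot (x - y) w = 0.
  transitivity (dot a w * len b - dot w b * len a); last by rewrite h subrr.
  by rewrite /x /y; unfold_coordinates; ring.
have dxy : x - y != 0.
  apply: contraNneq ab => /eqP; rewrite subr_eq0 => /eqP e.
  have : det2 x y = 0 by rewrite e /det2; ring.
  have -> : det2 x y = len a * len b * det2 a b.
    by rewrite /x /y; unfold_coordinates; ring.
  by move/eqP; rewrite mulf_eq0 gt_eqF ?mulr_gt0.
have par : det2 (x + y) w = 0.
  apply: (mulIf (lt0r_neq0 (dot_gt0 dxy))); rewrite mul0r.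
  transitivity ((dot x x - dot y y) * det2 (x - y) w -
      det2 (x - y) (x + y) * dot (x - y) w).
    by unfold_coordinates; ring.
  by rewrite xy subrr dw mul0r mulr0 subrr.
have k0 : len b * len a * dot w w * 2 != 0.
  by rewrite gt_eqF// !mulr_gt0.
apply: (mulIf k0); rewrite mul0r.
transitivity (2 * (dot w w * det2 (reflect_vector w x) y)).
  by rewrite /x reflect_vectorZ /y; unfold_coordinates; ring.
transitivity (2 * dot (x - y) w * det2 w y +
    det2 (x + y) w * (dot (x - y) w - dot (x + y) w)); last first.
  by rewrite par dw; ring.
move: ww; rewrite /reflect_vector; unfold_coordinates => ww.
by field; rewrite gt_eqF.
Qed.

End Angles.

(** * Threshold angles and the three regions *)

Lemma neg_cos_Psi_tail_itv (R : realType) (r : R) : 1 < r ->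
  0 <= neg_cos_Psi_tail r <= 1.
Proof.
move=> r1; rewrite /neg_cos_Psi_tail.
set h := Num.sqrt _; have h0 : 0 <= h by rewrite sqrtr_ge0.
have n0 : 0 < r ^+ 2 - 1 by rewrite subr_gt0 exprn_egt1.
have h2 : h ^+ 2 = (r ^+ 2 - 1) ^+ 2 + 8 * (r ^+ 2 - 1).
  have e : r ^+ 4 + 6 * r ^+ 2 - 7 = (r ^+ 2 - 1) ^+ 2 + 8 * (r ^+ 2 - 1).
    by ring.
  by rewrite sqr_sqrtr e; have := sqr_ge0 (r ^+ 2 - 1); lra.
(* From [h^2 = n^2 + 8 n] with [n = r^2 - 1] one gets [n <= h <= n + 4], which keeps the argument of
   [acos] in its domain. *)
have hl : r ^+ 2 - 1 <= h.
  by rewrite -(@ler_pXn2r _ 2) ?nnegrE ?(ltW n0)// h2; lra.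
have hu : h <= r ^+ 2 - 1 + 4.
  rewrite -(@ler_pXn2r _ 2) ?nnegrE//; last by lra.
  by rewrite h2 sqrrD; lra.
have r20 : 0 < 2 * r by lra.
apply/andP; split.
  by rewrite mulr_ge0// divr_ge0//; lra.
have : (- r ^+ 2 + h + 1) / (2 * r) <= 2 by rewrite ler_pdivrMr//; lra.
by lra.
Qed.

Lemma Psi1E (R : realType) (r : R) : 1 < r ->
  Psi1 r = acos (- neg_cos_Psi1 r) /\ - neg_cos_Psi1 r \in `[-1, 1].
Proof.
move=> r1; split; first by rewrite /Psi1 /neg_cos_Psi1; case: ifP.
rewrite in_itv /= lerN2 lerNl /neg_cos_Psi1; case: ifP => [h|_]; last first.
  by have /andP[? ?] := neg_cos_Psi_tail_itv r1; apply/andP; split; lra.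
have r0 : 0 < r by lra.
have : 0 < r^-1 by rewrite invr_gt0.
have : r^-1 < 1 by rewrite invf_lt1.
have : Num.sqrt 2 < 2 :> R.
  by rewrite -[ltRHS](@ger0_norm R)// -sqrtr_sqr ltr_sqrt//; lra.
by move=> ? ? ?; apply/andP; split; lra.
Qed.

Lemma Psi2E (R : realType) (r : R) : 1 < r ->
  Psi2 r = acos (- neg_cos_Psi2 r) /\ - neg_cos_Psi2 r \in `[-1, 1].
Proof.
move=> r1; split; first by rewrite /Psi2 /neg_cos_Psi2; case: ifP.
rewrite in_itv /= lerN2 lerNl /neg_cos_Psi2; case: ifP => [h|_]; last first.
  by have /andP[? ?] := neg_cos_Psi_tail_itv r1; apply/andP; split; lra.
have r0 : 0 < r by lra.
have : 0 < r^-1 by rewrite invr_gt0.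
have : r^-1 < 1 by rewrite invf_lt1.
have : 0 <= Num.sqrt (2 - r ^+ 2) by rewrite sqrtr_ge0.
have : Num.sqrt (2 - r ^+ 2) <= 1.
  have r2 : 1 < r ^+ 2 by rewrite exprn_egt1.
  by rewrite -[leRHS]sqrtr1 ler_sqrt//; lra.
by move=> ? ? ? ?; apply/andP; split; lra.
Qed.

Theorem corollary5p7 (R : realType) (P : parallelogram R)
    (K : set (R * R)) (r theta : R)
    (hK : K = body P)
    (hrect : ~ is_rectangle P) (hrhomb : ~ is_rhombus P)
    (hr : r = side_ratio P) (htheta : theta = larger_angle P) :
  [/\ regionB (r, theta) ->
        forall U : set (R * R), bisects_consecutive_edges P U ->
          minkowski_chirality1 K = circumradius K (reflection U @` K),
      regionD (r, theta) ->
        forall U : set (R * R), bisects_diagonals P U ->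
          minkowski_chirality1 K = circumradius K (reflection U @` K)
    & regionJ (r, theta) ->
        forall U : set (R * R), principal_axis (john_ellipse K) U ->
          minkowski_chirality1 K = circumradius K (reflection U @` K)].
Proof.
rewrite {}hK.
set u := side1 P; set v := side2 P.
have D0 : det2 u v != 0 := Defs.nondegenerate P.
have u0 : u != 0.
  by apply: contraNneq D0 => ->; rewrite /det2 /= !mul0r subrr.
have v0 : v != 0.
  by apply: contraNneq D0 => ->; rewrite /det2 /= !mulr0 subrr.
have lu := len_gt0 u0; have lv := len_gt0 v0.
have luv : len u != len v by apply/eqP.
pose kappa := dot u v / (len u * len v).
have kI : kappa \in `[-1, 1] by exact: cos_angle_itv.
have kB : 0 < `|kappa| < 1.
  apply/andP; split.
    rewrite normr_gt0; apply/eqP => k0; apply: hrect.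
    by rewrite /is_rectangle /angle -/u -/v -/kappa k0 acos0.
  rewrite -(@ltr_pXn2r R 2 isT) ?nnegrE// expr1n real_normK ?num_real//.
  rewrite cos_angle_sqr// gtrBl exprn_even_gt0//= mulf_neq0//.
  by rewrite invr_neq0// gt_eqF// mulr_gt0.
have kNI : - `|kappa| \in `[-1, 1].
  by rewrite in_itv /=; case/andP: kB => ? ?; apply/andP; split; lra.
(* The two interior angles have cosines [kappa] and [- kappa]; the larger angle belongs to the
   smaller cosine. *)
have thetaE : theta = acos (- `|kappa|).
  have e : angle (- u) v = acos (- kappa).
    by rewrite /angle dotNl lenN mulNr.
  have NkI : - kappa \in `[-1, 1].
    by move: kI; rewrite !in_itv /= => /andP[? ?]; apply/andP; split; lra.
  rewrite htheta /larger_angle -/u -/v e /angle -/kappa.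
  case: (ler0P kappa) => hk.
    rewrite opprK; apply/max_idPl; rewrite ler_acos//; lra.
  by apply/max_idPr; rewrite ler_acos//; lra.
have rE : r = Num.max (len u) (len v) / Num.min (len u) (len v) by [].
have triple w a b c : w != 0 -> reflection_matrix u v w a b c ->
    reflection_triple (len u) (len v) kappa a b c.
  move=> w0 M; have [Q L] := reflection_matrix_triple D0 w0 M; split => //.
  by rewrite !len_sqr L /kappa; field; rewrite !gt_eqF.
have reduce U : (exists2 w, w != 0 /\ (exists o, U = line o w) &
    forall a b c, reflection_matrix u v w a b c ->
    [\/ [/\ a = 0, neg_cos_Psi1 r < `|kappa| & `|kappa| < neg_cos_Psi2 r],
      c = - b /\ `|kappa| <= neg_cos_Psi1 r
    | c = b /\ neg_cos_Psi2 r <= `|kappa| ]) ->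
    minkowski_chirality1 (body P) =
      circumradius (body P) (reflection U @` body P).
  move=> [w [w0 [p ->]] h].
  have [a [b [c M]]] := reflection_matrix_ex D0 w0.
  apply: (chirality_attained p w0 M) => w' a' b' c' w'0 M'.
  apply: (reflection_triple_optimal lu lv luv kB (triple _ _ _ _ w0 M)
    (triple _ _ _ _ w'0 M')).
  by rewrite -rE; exact: h.
have le_Psi1 : 1 < r -> (theta <= Psi1 r) = (`|kappa| <= neg_cos_Psi1 r).
  by move=> /Psi1E[-> I1]; rewrite thetaE ler_acos// lerN2.
have Psi2_le : 1 < r -> (Psi2 r <= theta) = (neg_cos_Psi2 r <= `|kappa|).
  by move=> /Psi2E[-> I2]; rewrite thetaE ler_acos// lerN2.
have Sneg w x : reflect_vector w (- x) = - reflect_vector w x.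
  by rewrite -scaleN1r reflect_vectorZ scaleN1r.
have D2N x y : det2 (- x) y = - det2 x y by rewrite /det2 /=; ring.
have D2Nr x y : det2 x (- y) = - det2 x y by rewrite /det2 /=; ring.
split.
- move=> [[/= r1 /andP[t1 t2]] nJD] U hU; apply: reduce.
  have hk1 : neg_cos_Psi1 r < `|kappa|.
    rewrite ltNge -le_Psi1//; apply/negP => h; apply: nJD; right.
    by split => //=; rewrite t1.
  have hk2 : `|kappa| < neg_cos_Psi2 r.
    rewrite ltNge -Psi2_le//; apply/negP => h; apply: nJD; left.
    by split => //=; rewrite h.
  have [w [w0 UE] e] : exists2 w, w != 0 /\ (exists o, U = line o w) &
      det2 (reflect_vector w u) v = 0.
    case: hU => /bisects_reflect; rewrite ?D2N ?D2Nr ?oppr_eq0;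
      move=> /(_ D0)[w [w0 UE]];
      rewrite ?Sneg ?D2N ?D2Nr => /eqP; rewrite ?oppr_eq0 => /eqP e;
      by exists w; [split; [|eexists; exact: UE]|].
  exists w => // a b c [M1 M2]; apply: Or31; split => //.
  (* The determinant of the image of [u] with [v] is [a] times that of [u] with [v]. *)
  apply: (mulIf D0); rewrite mul0r -[RHS]e M1.
  by unfold_coordinates; ring.
- move=> [/= r1 /andP[t1 t2]] U hU; apply: reduce.
  rewrite le_Psi1// in t2.
  have dd : det2 (u + v) (v - u) != 0.
    have -> : det2 (u + v) (v - u) = 2 * det2 u v by unfold_coordinates; ring.
    by rewrite mulf_neq0.
  have [w [w0 UE] e] : exists2 w, w != 0 /\ (exists o, U = line o w) &
      det2 (reflect_vector w (u + v)) (v - u) = 0.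
    case: hU => /bisects_reflect; rewrite ?D2Nr ?oppr_eq0 => /(_ dd)[w [w0 UE]];
      rewrite ?D2Nr => /eqP; rewrite ?oppr_eq0 => /eqP e;
      by exists w; [split; [|eexists; exact: UE]|].
  exists w => // a b c [M1 M2]; apply: Or32; split => //.
  (* The image of [u + v] is [(a + b) u + (c - a) v], whose determinant with [v - u] is [b + c]
     times that of [u] with [v]. *)
  apply/eqP; rewrite -addr_eq0; apply/eqP; apply: (mulIf D0).
  rewrite mul0r -[RHS]e reflect_vectorD M1 M2.
  by unfold_coordinates; ring.
- move=> [/= r1 /andP[t1 t2]] U hU; apply: reduce.
  rewrite Psi2_le// in t1.
  have [p [w [w0 -> h]]] := john_axis_reflection hU.
  exists w; first by split => //; exists p.
  by move=> a b c M; apply: Or33; split => //; exact: h M.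
Qed.
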